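(* Let $M>0$, $n\ge3$, $\delta\in(0,1)$, and let $\mathcal{J}$ be a finite set of $n\times n$ interaction matrices, all of whose elements satisfy $\|J\|_\infty\le M$. Let $x\sim\Pr_{J^*}$ be a single sample with $J^*\in\mathcal{J}$, and let $\hat J=\hat J(x)$ be a minimizer of $\varphi(x;J)$ over $J\in\mathcal{J}$. Then with probability at least $1-\delta$, $$\|\hat J-J^*\|_F\le C(M)\sqrt{\log|\mathcal{J}|+\log(1/\delta)+\log\log n},$$ where $C(M)$ is a (singly) exponential function of $M$. Moreover, $\hat J$ can be computed in time $\mathrm{poly}(|\mathcal{J}|,n)$.
   Context: An interaction matrix is a real symmetric $n\times n$ matrix $J$ with zero diagonal. The Ising model $\Pr_J$ is the distribution on $\{\pm1\}^n$ with $\Pr_J[x]\propto\exp(x^\top Jx/2)$. $\|J\|_\infty=\max_i\sum_j|J_{ij}|$ and $\|\cdot\|_F$ is the Frobenius norm. The negative log pseudo-likelihood is $\varphi(x;J)=-\sum_{i=1}^n\log\Pr_J[x_i\mid x_{-i}]$, where $x_{-i}$ denotes all coordinates of $x$ except the $i$-th. ''Singly exponential'' means bounded by $ae^{bM}$ for universal constants $a,b>0$. *)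

(* Defs.v *)
From mathcomp Require Import all_boot all_order all_algebra finmap.
From mathcomp Require Import all_classical all_reals all_analysis.

Set Implicit Arguments.
Unset Strict Implicit.
Unset Printing Implicit Defensive.

Import Order.TTheory GRing.Theory Num.Theory.

Local Open Scope ring_scope.

(** * Ising models and pseudo-likelihood *)

Section Ising.
Variables (R : realType) (n : nat).
Implicit Types (J : 'M[R]_n).

Definition interaction_matrix J : Prop :=
  J^T = J /\ forall i, J i i = 0.

Definition infty_norm J : R := \big[Num.max/0]_i \sum_j `|J i j|.

Definition frobenius_norm J : R := Num.sqrt (\sum_i \sum_j J i j ^+ 2).

(* A configuration in {+1,-1}^n is stored as its vector of signs:
   [false] stands for +1 and [true] for -1. *)
Definition config := {ffun 'I_n -> bool}.
Implicit Types (x y : config).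

Definition spins x : 'cV[R]_n := \col_i (-1) ^+ x i.

Definition ising_weight J x : R :=
  expR (((spins x)^T *m J *m spins x) 0 0 / 2).

Definition ising J x : R := ising_weight J x / \sum_y ising_weight J y.

Definition ising_prob J (E : pred config) : R := \sum_(x | E x) ising J x.

(* Pr_J[x_i | x_{-i}], the conditioning event having positive probability. *)
Definition ising_cond J x (i : 'I_n) : R :=
  ising J x / ising_prob J [pred y : config | [forall j, (j != i) ==> (y j == x j)]].

Definition neg_log_pl x J : R := - \sum_i ln (ising_cond J x i).

Definition pl_minimizer (Js : {fset 'M[R]_n}) x J : Prop :=
  J \in Js /\ forall J', J' \in Js -> neg_log_pl x J <= neg_log_pl x J'.

End Ising.

Definition singly_exponential (R : realType) (C : R -> R) : Prop :=
  exists a b : R,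
    [/\ 0 < a, 0 < b & forall M, 0 < M -> C M <= a * expR (b * M)].

(** * A real-RAM

  Unit-cost programs over natural-number registers (used as counters and
  addresses), real registers, and a real memory addressed indirectly through the
  natural-number registers. Programs are finite and contain no real constant
  other than natural numbers, there is no multiplication on natural-number
  registers, so addresses reached in t steps have O(t) bits, and there is no
  conversion from reals to naturals (no floor). *)

Inductive instr :=
  | NSet of nat & nat          (* n_d := c *)
  | NMov of nat & nat          (* n_d := n_a *)
  | NAdd of nat & nat & nat    (* n_d := n_a + n_b *)
  | NSub of nat & nat & nat    (* n_d := n_a - n_b, truncated *)
  | RSet of nat & nat          (* r_d := c *)
  | RMov of nat & nat
  | RAdd of nat & nat & nat
  | RSub of nat & nat & nat
  | RMul of nat & nat & nat
  | RDiv of nat & nat & nat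
  | RExp of nat & nat
  | RLn of nat & nat
  | RLoad of nat & nat         (* r_d := mem[n_a] *)
  | RStore of nat & nat.       (* mem[n_a] := r_b *)

Inductive test :=
  | NLt of nat & nat           (* n_a < n_b *)
  | RLt of nat & nat.          (* r_a < r_b *)

Inductive prog :=
  | Skip
  | Instr of instr
  | Seq of prog & prog
  | If of test & prog & prog
  | While of test & prog.

Record state (R : realType) := State {
  nreg : nat -> nat;
  rreg : nat -> R;
  rmem : nat -> R }.

Definition upd (T : Type) (f : nat -> T) (k : nat) (v : T) : nat -> T :=
  fun l => if l == k then v else f l.

Section Semantics.
Variable R : realType.
Implicit Types (s : state R).

Definition set_n s d v := State (upd (nreg s) d v) (rreg s) (rmem s).
Definition set_r s d v := State (nreg s) (upd (rreg s) d v) (rmem s).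
Definition set_m s a v := State (nreg s) (rreg s) (upd (rmem s) a v).

Definition run_instr (c : instr) s : state R :=
  match c with
  | NSet d k => set_n s d k
  | NMov d a => set_n s d (nreg s a)
  | NAdd d a b => set_n s d (nreg s a + nreg s b)%N
  | NSub d a b => set_n s d (nreg s a - nreg s b)%N
  | RSet d k => set_r s d k%:R
  | RMov d a => set_r s d (rreg s a)
  | RAdd d a b => set_r s d (rreg s a + rreg s b)
  | RSub d a b => set_r s d (rreg s a - rreg s b)
  | RMul d a b => set_r s d (rreg s a * rreg s b)
  | RDiv d a b => set_r s d (rreg s a / rreg s b)
  | RExp d a => set_r s d (expR (rreg s a))
  | RLn d a => set_r s d (ln (rreg s a))
  | RLoad d a => set_r s d (rmem s (nreg s a))
  | RStore a b => set_m s (nreg s a) (rreg s b)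
  end.

Definition run_test (c : test) s : bool :=
  match c with
  | NLt a b => (nreg s a < nreg s b)%N
  | RLt a b => rreg s a < rreg s b
  end.

(* [exec p s t s']: started in [s], [p] halts in [s'] after exactly [t] steps,
   each instruction and each evaluation of a test counting for one step. *)
Inductive exec : prog -> state R -> nat -> state R -> Prop :=
  | ExecSkip s : exec Skip s 1 s
  | ExecInstr c s : exec (Instr c) s 1 (run_instr c s)
  | ExecSeq p q s1 s2 s3 t u :
      exec p s1 t s2 -> exec q s2 u s3 -> exec (Seq p q) s1 (t + u) s3
  | ExecIf c p q s1 s2 t :
      exec (if run_test c s1 then p else q) s1 t s2 ->
      exec (If c p q) s1 t.+1 s2
  | ExecWhileF c p s : ~~ run_test c s -> exec (While c p) s 1 s
  | ExecWhileT c p s1 s2 s3 t u :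
      run_test c s1 -> exec p s1 t s2 -> exec (While c p) s2 u s3 ->
      exec (While c p) s1 (t + u).+1 s3.

(* Row-major list of entries. *)
Definition mx_entries n (J : 'M[R]_n) : seq R :=
  [seq J i j | i <- enum 'I_n, j <- enum 'I_n].

(* Input: n and the number of matrices in the natural-number registers 0 and 1;
   in memory, from address 0 on, the n spins followed by the entries of the
   matrices one after the other; 0 everywhere else. *)
Definition input_state n (x : config n) (s : seq 'M[R]_n) : state R :=
  State (nth 0%N [:: n; size s])
        (fun=> 0)
        (nth 0 ([seq spins R x i 0 | i <- enum 'I_n]
                  ++ flatten [seq mx_entries J | J <- s])).

(* Output: a matrix written in memory from address 0 on. *)
Definition outputs_mx n (st : state R) (J : 'M[R]_n) : Prop :=
  mkseq (rmem st) (n * n) = mx_entries J.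

End Semantics.

(* Main.v *)
Require Import Defs.
From mathcomp Require Import all_boot all_order all_algebra finmap.
From mathcomp Require Import all_classical all_reals all_analysis.
From mathcomp Require Import ring lra zify.

Set Implicit Arguments.
Unset Strict Implicit.
Unset Printing Implicit Defensive.

Import Order.TTheory GRing.Theory Num.Theory.

Local Open Scope ring_scope.

(** Write [A = J - Jstar], and for a configuration [x] let [t] be the vector of
conditional means of the spins under [Jstar], so that [t_i = tanh ((Jstar x)_i)].
The log-likelihood of a spin is strongly concave in its local field, hence
whenever [J] beats [Jstar] on [x] the gain
[g = <Ax, x - t> - c |Ax|^2] is non-negative, with [c] of order [exp (-4M)].
It suffices to prove [Pr (g >= 0) <= exp (- k |A|_F^2)] with [1/k] singly
exponential in [M]; a union bound over the finite family does the rest.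

Large interactions rule out Dobrushin-type arguments, so the tail is obtained by
tilting. Jensen's inequality gives
[E exp (theta g) <= exp (theta E_theta g)], where [E_theta] is the average under
the measure reweighted by [exp (theta g)] (lemma [tilted_jensen]), so
that an upper bound on the single average [E_theta g] is enough. For small [theta] the tilt moves the conditional means by a vector
[tau] with [|tau|^2 <= K theta^2 (|Ax|^2 + |A(x - t)|^2 + |A|_F^2)]
([sum_tau_sq]). The remaining input is Stein's identity ([stein]): against the
centred spin [x_i - E_theta (x_i | others)], a function contributes only through
its discrete derivative in direction [i]. It yields three bounds, each up to an
error of order [theta] times the sum of the three squared norms.
- [E_theta <Ax, x - t>] vanishes, because [(Ax)_i] does not involve [x_i]
  ([mean_cross_le]).
- [E_theta |A(x - t)|^2] is at most a constant times [|A|_F^2]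
  ([mean_sqres_le]).
- [E_theta <Ax, A(x - t)>] is at least [exp (-2M) |A|_F^2]
  ([frob_le_mean]). By Cauchy-Schwarz and the previous bound this forces
  [E_theta |Ax|^2] to be at least a constant times [|A|_F^2], as in the proof of
  the Cramer-Rao inequality.
Together they give [E_theta g <= - const |A|_F^2] ([drift_arithmetic]), and
[gain_tail] follows.

For the algorithm, minimising the negative log pseudo-likelihood amounts to
maximising the product over [i] of [1 / (1 + exp (- 2 x_i (J x)_i))]. This
product is positive, so 0 serves as the initial record, and one pass over the
memory evaluates it for every matrix; the best one is then copied to the front.
Running times are tracked by [runs], a time-bounded total-correctness triple, and
loops by [runs_for]. *)

(** * The hyperbolic tangent and the logistic loss *)

Section Scalar.
Variable R : realType.
Implicit Types a b d m u x y z M c : R.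

(** The hyperbolic tangent, in the form in which it is the mean of a spin that
takes the values 1 and -1 with weights [expR u] and [expR (- u)]. *)
Definition th u : R := 1 - 2 / (1 + expR (2 * u)).

Lemma expR_add1_gt0 u : 0 < 1 + expR u.
Proof. by rewrite ltr_wpDl ?expR_gt0. Qed.

Lemma thN u : th (- u) = - th u.
Proof.
rewrite /th mulrN expRN; have := expR_gt0 (2 * u); set e := expR _ => e0.
by field; rewrite !gt_eqF ?addr_gt0.
Qed.

Lemma th_lt1 u : th u < 1.
Proof. by rewrite /th ltrBlDr ltrDl divr_gt0 ?expR_add1_gt0. Qed.

Lemma normr_th_le1 u : `|th u| <= 1.
Proof.
by rewrite ler_norml lerNl -thN !ltW ?th_lt1.
Qed.

Lemma th_gap M u : `|u| <= M -> expR (- (2 * M)) <= 1 - th u.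
Proof.
move=> uM.
have -> : 1 - th u = 2 / (1 + expR (2 * u)) by rewrite /th; ring.
rewrite ler_pdivlMr ?expR_add1_gt0// mulrDr mulr1 -expRD.
have h1 : expR (- (2 * M)) <= 1 by rewrite expR_le1 oppr_le0; have := normr_ge0 u; lra.
have h2 : expR (- (2 * M) + 2 * u) <= 1.
  by rewrite expR_le1; have := ler_norm u; lra.
lra.
Qed.

Lemma normr_th_gap M u : `|u| <= M -> expR (- (2 * M)) <= 1 - `|th u|.
Proof.
move=> uM; case: (ler0P (th u)) => _; last exact: th_gap.
by rewrite -(thN u); apply: th_gap; rewrite normrN.
Qed.

(** With [P = expR a] and [Q = expR b] the difference is
[2 (P^2 - Q^2) / ((1 + P^2) (1 + Q^2))], and the denominator dominates
[(P + Q)^2] since the difference of the two is [(1 - P Q)^2]. *)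
Lemma th_diff_le a b : b <= a -> th a - th b <= 2 * (a - b).
Proof.
move=> ba; have A0 := expR_gt0 a; have B0 := expR_gt0 b.
have dbl u : expR (2 * u) = expR u * expR u by rewrite -expRD; congr expR; ring.
have -> : th a - th b = 2 * (expR a * expR a - expR b * expR b) /
   ((1 + expR a * expR a) * (1 + expR b * expR b)).
  by rewrite /th !dbl; field; rewrite !gt_eqF// addr_gt0// mulr_gt0.
rewrite ler_pdivrMr; last by rewrite mulr_gt0// addr_gt0// mulr_gt0.
have AB : expR a - expR b <= (a - b) * expR a.
  have := expR_ge1Dx (b - a); rewrite expRD expRN => h.
  have : expR a * (1 + (b - a)) <= expR a * (expR b * (expR a)^-1).
    by rewrite ler_pM2l.
  by rewrite mulrCA mulfV ?gt_eqF// mulr1; lra.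
move: AB A0 B0; set A := expR a; set B := expR b => AB A0 B0.
have d0 : 0 <= a - b by rewrite subr_ge0.
rewrite -mulrA ler_pM2l//.
have -> : A * A - B * B = (A - B) * (A + B) by ring.
apply: (@le_trans _ _ ((a - b) * A * (A + B))).
  by rewrite ler_wpM2r// addr_ge0// ltW.
rewrite -mulrA ler_wpM2l//.
have := mulr_gt0 A0 B0; have := sqr_ge0 (1 - A * B); nra.
Qed.

Lemma th_lipschitz a b : `|th a - th b| <= 2 * `|a - b|.
Proof.
wlog ba : a b / b <= a => [hw|].
  case/orP: (le_total b a) => ba; first exact: hw.
  by rewrite distrC (distrC a); exact: hw.
have mono : 0 <= th a - th b.
  have -> : th a - th b = 2 / (1 + expR (2 * b)) - 2 / (1 + expR (2 * a)).
    by rewrite /th; ring.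
  rewrite subr_ge0 ler_pM2l// lef_pV2 ?posrE ?expR_add1_gt0// lerD2l ler_expR; lra.
by rewrite ger0_norm// [X in _ <= 2 * X]ger0_norm ?subr_ge0// th_diff_le.
Qed.

(** For [y >= -2] square the bound [1 + y/2 <= expR (y/2)]; below -2 the
quadratic is non-positive. *)
Lemma expR_ge_quadratic k Y y : 0 <= k -> k <= 4^-1 -> k * Y <= 2^-1 ->
  `|y| <= Y -> 1 + y + k * y ^+ 2 <= expR y.
Proof.
move=> k0 k4 kY yY.
case: (lerP (- 2) y) => y2.
  have h := expR_ge1Dx (y / 2).
  have -> : expR y = expR (y / 2) ^+ 2.
    by rewrite expr2 -expRD; congr expR; field.
  have h0 : 0 <= 1 + y / 2 by lra.
  apply: (@le_trans _ _ ((1 + y / 2) ^+ 2)).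
    have := sqr_ge0 y; nra.
  by rewrite ler_pXn2r// nnegrE expR_ge0.
apply: (@le_trans _ _ 0); last exact: expR_ge0.
have yn : `|y| = - y by rewrite ltr0_norm//; lra.
rewrite yn in yY.
have : k * (- y) <= 2^-1 by apply: le_trans kY; rewrite ler_wpM2l.
nra.
Qed.

Lemma ln_ge_frac z Z : 0 <= z -> z <= Z -> z / (1 + Z) <= ln (1 + z).
Proof.
move=> z0 zZ.
have h : ln ((1 + z)^-1) <= (1 + z)^-1 - 1.
  have := @le_ln1Dx R ((1 + z)^-1 - 1).
  rewrite subrKC; apply; rewrite ltrBrDr addNr invr_gt0; lra.
rewrite lnV ?posrE in h; last lra.
apply: (@le_trans _ _ (z / (1 + z))).
  by rewrite ler_wpM2l// lef_pV2 ?posrE; lra.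
have -> : z / (1 + z) = 1 - (1 + z)^-1 by field; rewrite gt_eqF//; lra.
lra.
Qed.

(** The change of loss is the logarithm of a mixture [p e^(2qd) + q e^(-2pd)],
whose exponents have mean zero under the weights [p, q]. The linear terms
therefore cancel and the quadratic lower bound on the exponential leaves a
variance, at least a multiple of [p q d^2]. *)
Lemma logistic_strongly_convex M y d : 0 <= M ->
  `|y| <= M -> `|d| <= 2 * M ->
  expR (- (4 * M)) / 8 * d ^+ 2 - d * (1 - th y) <=
  ln (1 + expR (- (2 * (y + d)))) - ln (1 + expR (- (2 * y))).
Proof.
move=> M0 yM dM.
set p := (1 + expR (- (2 * y)))^-1; set q := (1 + expR (2 * y))^-1.
have p0 : 0 < p by rewrite invr_gt0 expR_add1_gt0.
have q0 : 0 < q by rewrite invr_gt0 expR_add1_gt0.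
have pq1 : p + q = 1.
  rewrite /p /q expRN; have := expR_gt0 (2 * y); set e := expR _ => e0.
  by field; rewrite !gt_eqF ?addr_gt0.
have pE : p = 1 - q by lra.
have thE : 1 - th y = 2 * q by rewrite /th /q; ring.
have qeE : q = p * expR (- (2 * y)).
  rewrite /p /q expRN; have := expR_gt0 (2 * y); set e := expR _ => e0.
  by field; rewrite !gt_eqF ?addr_gt0.
set s := p * expR (2 * q * d) + q * expR (- (2 * p * d)).
have ratioE : ln (1 + expR (- (2 * (y + d)))) - ln (1 + expR (- (2 * y)))
    = ln s - 2 * q * d.
  rewrite -ln_div ?posrE ?expR_add1_gt0//.
  have s0 : 0 < s by rewrite addr_gt0// mulr_gt0// expR_gt0.
  rewrite -[X in _ = _ - X]expRK -ln_div ?posrE ?expR_gt0//; congr ln.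
  rewrite -/p.
  have -> : expR (- (2 * (y + d))) = expR (- (2 * y)) * expR (- (2 * d)).
    by rewrite -expRD; congr expR; ring.
  have -> : (1 + expR (- (2 * y)) * expR (- (2 * d))) * p
      = p + q * expR (- (2 * d)) by rewrite qeE; ring.
  rewrite /s [RHS]mulrDl mulfK ?gt_eqF ?expR_gt0//.
  have -> : expR (- (2 * d)) = expR (- (2 * p * d)) / expR (2 * q * d).
    by rewrite -expRN -expRD; congr expR; rewrite pE; ring.
  by rewrite mulrA.
rewrite ratioE thE.
(* All exponents below have absolute value at most 4M, and [k * (4M) <= 1/2]. *)
set k := (8 * (1 + M))^-1.
have k0 : 0 < k by rewrite invr_gt0; lra.
have kM : k * (8 * (1 + M)) = 1 by rewrite mulVf// gt_eqF//; lra.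
have pq8 : expR (- (2 * M)) <= 4 * (p * q).
  have hp : expR (- (2 * M)) <= 2 * p.
    have := @th_gap M (- y); rewrite normrN => /(_ yM); rewrite thN.
    by have := thE; lra.
  have hq : expR (- (2 * M)) <= 2 * q by rewrite -thE th_gap.
  have : expR (- (2 * M)) <= 1 by rewrite expR_le1 oppr_le0; lra.
  have := expR_gt0 (- (2 * M)); nra.
have small r : 0 < r -> r <= 1 -> `|2 * r * d| <= 4 * M.
  move=> r0 r1; rewrite !normrM (ger0_norm (ltW r0)) ger0_norm//.
  by have := normr_ge0 d; nra.
have k1 : k <= 4^-1 by have := mulr_ge0 (ltW k0) M0; lra.
have k2 : k * (4 * M) <= 2^-1 by lra.
have e1 := expR_ge_quadratic (ltW k0) k1 k2 (small q q0 ltac:(lra)).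
have e2 : 1 - 2 * p * d + k * (2 * p * d) ^+ 2 <= expR (- (2 * p * d)).
  have := @expR_ge_quadratic k (4 * M) (- (2 * p * d)) (ltW k0) k1 k2.
  by rewrite normrN sqrrN; apply; apply: small; lra.
set z := 4 * (p * q) * k * d ^+ 2.
have sz : 1 + z <= s.
  have : p * (1 + 2 * q * d + k * (2 * q * d) ^+ 2)
       + q * (1 - 2 * p * d + k * (2 * p * d) ^+ 2) <= s.
    by rewrite lerD// ler_pM2l.
  apply: le_trans; rewrite le_eqVlt; apply/orP; left; apply/eqP.
  by rewrite /z pE; ring.
have pq0 := mulr_gt0 p0 q0.
have kd0 : 0 <= k * d ^+ 2 by rewrite mulr_ge0 ?sqr_ge0// ltW.
have z0 : 0 <= z by rewrite /z -mulrA mulr_ge0//; lra.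
have zM : z <= M.
  have pq4 : 4 * (p * q) <= 1 by have := sqr_ge0 (p - q); have := pq1; nra.
  have d4 : d ^+ 2 <= 4 * M ^+ 2.
    have : `|d| ^+ 2 <= (2 * M) ^+ 2 by rewrite ler_pXn2r// nnegrE; lra.
    by rewrite real_normK ?num_real//; lra.
  apply: (@le_trans _ _ (k * (4 * M ^+ 2))).
    rewrite /z -mulrA -[leRHS]mul1r; apply: ler_pM => //; first lra.
    by rewrite ler_pM2l.
  have := mulr_ge0 (ltW k0) M0; nra.
have lnz := ln_ge_frac z0 zM.
have : ln (1 + z) <= ln s by rewrite ler_ln ?posrE//; lra.
have : expR (- (4 * M)) / 8 * d ^+ 2 <= z / (1 + M).
  rewrite /z ler_pdivlMr; last lra.
  have -> : expR (- (4 * M)) = expR (- (2 * M)) * expR (- M) * expR (- M).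
    by rewrite -!expRD; congr expR; ring.
  have eM : expR (- M) * (1 + M) <= 1.
    rewrite expRN ler_pdivrMl ?expR_gt0// mulr1; exact: expR_ge1Dx.
  have -> : 4 * (p * q) * k * d ^+ 2 = (4 * (p * q)) * (k * d ^+ 2) by ring.
  have -> : expR (- (2 * M)) * expR (- M) * expR (- M) / 8 * d ^+ 2 * (1 + M)
     = expR (- (2 * M)) * ((expR (- M) * (1 + M)) * (expR (- M) / 8) * d ^+ 2) by ring.
  apply: ler_pM => //; rewrite ?expR_ge0//.
    apply: mulr_ge0; last exact: sqr_ge0.
    by rewrite mulr_ge0 ?mulr_ge0 ?divr_ge0 ?expR_ge0//; lra.
  rewrite ler_wpM2r ?sqr_ge0//.
  have : expR (- M) / 8 <= k.
    rewrite /k -[leRHS]mul1r ler_pdivlMr; lra.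
  have := expR_gt0 (- M); nra.
lra.
Qed.

Lemma expR1_le3 : expR 1 <= 3 :> R.
Proof.
have h := expR_ge1Dx (- 6^-1 : R).
have -> : expR 1 = expR (6^-1) ^+ 6 :> R.
  by rewrite -expRM_natl; congr expR; field.
rewrite -[expR _]invrK -expRN.
apply: (@le_trans _ _ ((5 / 6)^-1 ^+ 6)); last lra.
by rewrite ler_pXn2r ?nnegrE ?invr_ge0 ?expR_ge0// lef_pV2 ?posrE ?expR_gt0//; lra.
Qed.

End Scalar.

(** * Gibbs averages, spin flips and the tilting inequality *)

Section Gibbs.
Variables (R : realType) (n : nat).
Implicit Types (x : config n) (i j : 'I_n) (h k H : config n -> R).

Definition spin x i : R := (-1) ^+ x i.

Definition flip i x : config n := [ffun j => if j == i then ~~ x j else x j].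

(** Half the increment under a flip; [spin x i * dif i h x] is the discrete partial
derivative of [h], which no longer depends on the spin at [i]. *)
Definition dif i h x : R := (h x - h (flip i x)) / 2.

(** The expectation of [h] under the measure with density proportional to
[expR (H x)]. *)
Definition gibbs_mean H h : R :=
  (\sum_x expR (H x) * h x) / \sum_x expR (H x).

Lemma spin2 x i : spin x i * spin x i = 1.
Proof. by rewrite -expr2 sqrr_sign. Qed.

Lemma sqr_spin x i : spin x i ^+ 2 = 1.
Proof. exact: sqrr_sign. Qed.

Lemma normr_spin x i : `|spin x i| = 1.
Proof. exact: normr_sign. Qed.

Lemma flipK i : involutive (flip i).
Proof. by move=> x; apply/ffunP => j; rewrite !ffunE; case: eqP => //; rewrite negbK. Qed.

Lemma spin_flip i x j : spin (flip i x) j = if j == i then - spin x j else spin x j.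
Proof. by rewrite /spin ffunE; case: eqP => // _; case: (x j); rewrite /= ?expr1 ?expr0 ?opprK. Qed.

Lemma dif_spin i x j : dif i (spin^~ j) x = if j == i then spin x j else 0.
Proof.
by rewrite /dif spin_flip; case: eqP => _; [field|rewrite subrr mul0r].
Qed.

Lemma spin_dif_flip i h x : spin (flip i x) i * dif i h (flip i x) = spin x i * dif i h x.
Proof. by rewrite spin_flip eqxx /dif flipK; ring. Qed.

Lemma difD i h k x : dif i (fun x => h x + k x) x = dif i h x + dif i k x.
Proof. by rewrite /dif; ring. Qed.

Lemma difB i h k x : dif i (fun x => h x - k x) x = dif i h x - dif i k x.
Proof. by rewrite /dif; ring. Qed.

Lemma difZ i (a : R) h x : dif i (fun x => a * h x) x = a * dif i h x.
Proof. by rewrite /dif; ring. Qed.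

(** The Leibniz rule acquires a second-order term because flips are finite
increments. *)
Lemma difM i h k x :
  dif i (fun x => h x * k x) x =
  dif i h x * k x + h x * dif i k x - 2 * (dif i h x * dif i k x).
Proof. by rewrite /dif; field. Qed.

Lemma dif_sum i (I : finType) (h : I -> config n -> R) x :
  dif i (fun x => \sum_a h a x) x = \sum_a dif i (h a) x.
Proof. by rewrite /dif -sumrB -mulr_suml. Qed.

Lemma partition_gt0 H : 0 < \sum_x expR (H x).
Proof.
rewrite (bigD1 [ffun=> false])//= ltr_pwDl ?expR_gt0//.
by apply: sumr_ge0 => x _; exact: expR_ge0.
Qed.

Lemma gibbs_mean_cst H (a : R) : gibbs_mean H (fun=> a) = a.
Proof. by rewrite /gibbs_mean -mulr_suml mulrAC mulfV ?mul1r// gt_eqF// partition_gt0. Qed.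

Lemma gibbs_meanD H h k :
  gibbs_mean H (fun x => h x + k x) = gibbs_mean H h + gibbs_mean H k.
Proof.
rewrite /gibbs_mean -mulrDl -big_split/=; congr (_ / _).
by apply: eq_bigr => x _; rewrite mulrDr.
Qed.

Lemma gibbs_meanZ H (a : R) h :
  gibbs_mean H (fun x => a * h x) = a * gibbs_mean H h.
Proof.
rewrite /gibbs_mean mulrA mulr_sumr; congr (_ / _).
by apply: eq_bigr => x _; rewrite mulrCA.
Qed.

Lemma gibbs_mean_sum H (I : finType) (h : I -> config n -> R) :
  gibbs_mean H (fun x => \sum_a h a x) = \sum_a gibbs_mean H (h a).
Proof.
rewrite /gibbs_mean -mulr_suml exchange_big/=; congr (_ / _).
by apply: eq_bigr => x _; rewrite mulr_sumr.
Qed.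

Lemma eq_gibbs_mean H h k : h =1 k -> gibbs_mean H h = gibbs_mean H k.
Proof. by move=> hk; congr (_ / _); apply: eq_bigr => x _; rewrite hk. Qed.

Lemma le_gibbs_mean H h k :
  (forall x, h x <= k x) -> gibbs_mean H h <= gibbs_mean H k.
Proof.
move=> hk; rewrite ler_pM2r ?invr_gt0 ?partition_gt0//.
by apply: ler_sum => x _; rewrite ler_pM2l ?expR_gt0.
Qed.

(** Detailed balance: [th (spin x i * dif i H x)] is the conditional mean of the
[i]-th spin given the others. *)
Lemma flip_balance i H x (T := th (spin x i * dif i H x)) :
  expR (H x) * (spin x i - T) + expR (H (flip i x)) * (- spin x i - T) = 0.
Proof.
have -> : T = spin x i * th (dif i H x).
  by rewrite /T /spin; case: (x i); rewrite /= ?expr1 ?expr0 ?mulN1r ?mul1r ?thN.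
have -> : expR (H x) = expR (2 * dif i H x) * expR (H (flip i x)).
  by rewrite -expRD; congr expR; rewrite /dif; field.
rewrite /th; have := expR_gt0 (2 * dif i H x); set e := expR _ => e0.
by field; rewrite gt_eqF// addr_gt0.
Qed.

(** The difference [h - dif i h] averages [h] over the two values of the [i]-th
spin, so it does not depend on that spin and is orthogonal to the centred spin. *)
Lemma stein i H h (t := fun x => th (spin x i * dif i H x)) :
  gibbs_mean H (fun x => h x * (spin x i - t x)) =
  gibbs_mean H (fun x => dif i h x * (spin x i - t x)).
Proof.
apply/eqP; rewrite -subr_eq0 -mulrBl mulf_eq0; apply/orP; left.
rewrite -sumrB; under eq_bigr => x _ do rewrite -mulrBr -mulrBl.
set F := fun x => expR (H x) * ((h x - dif i h x) * (spin x i - t x)).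
(* The sum is invariant under the flip, and the two halves cancel by detailed
   balance. *)
have reidx : \sum_x F x = \sum_x F (flip i x).
  rewrite (reindex (flip i))//=.
  by exists (flip i) => x _; exact: flipK.
rewrite -[X in X == _]/(\sum_x F x).
have : \sum_x F x + \sum_x F (flip i x) = 0.
  rewrite -big_split/= big1// => x _.
  have := flip_balance i H x; rewrite /F /t spin_dif_flip spin_flip eqxx.
  have -> : h (flip i x) - dif i h (flip i x) = h x - dif i h x.
    by rewrite /dif flipK; field.
  set T := th _; set k := h x - _ => hk.
  have -> : expR (H x) * (k * (spin x i - T)) + expR (H (flip i x)) * (k * (- spin x i - T))
   = k * (expR (H x) * (spin x i - T) + expR (H (flip i x)) * (- spin x i - T)) by ring.
  by rewrite hk mulr0.
by rewrite -reidx => ?; apply/eqP; lra.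
Qed.

(** Jensen's inequality for [expR (- theta g)] under the tilted measure: the
inverse of the left-hand side is the tilted average of that function. *)
Lemma tilted_jensen (H g : config n -> R) (theta : R) :
  gibbs_mean H (fun x => expR (theta * g x)) <=
  expR (theta * gibbs_mean (fun x => H x + theta * g x) g).
Proof.
set H' := fun x => H x + theta * g x; set mu := gibbs_mean H' g.
rewrite ler_pdivrMr ?partition_gt0//.
have -> : \sum_x expR (H x) * expR (theta * g x) = \sum_x expR (H' x).
  by apply: eq_bigr => x _; rewrite -expRD.
rewrite mulr_sumr.
have muE : mu * \sum_x expR (H' x) = \sum_x expR (H' x) * g x.
  by rewrite /mu /gibbs_mean divfK// gt_eqF// partition_gt0.
apply: (@le_trans _ _ (\sum_x expR (H' x) * (1 - theta * (g x - mu)))).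
  rewrite le_eqVlt; apply/orP; left; apply/eqP.
  have -> : \sum_x expR (H' x) * (1 - theta * (g x - mu)) =
      \sum_x expR (H' x) * (1 + theta * mu) - theta * \sum_x expR (H' x) * g x.
    rewrite mulr_sumr -sumrB; apply: eq_bigr => x _; ring.
  by rewrite -muE -mulr_suml; ring.
apply: ler_sum => x _.
have -> : expR (theta * mu) * expR (H x) =
    expR (H' x) * expR (- (theta * (g x - mu))).
  by rewrite -!expRD; congr expR; rewrite /H'; ring.
by rewrite ler_pM2l ?expR_gt0//; exact: expR_ge1Dx.
Qed.

(** A Chernoff bound in which a negative drift under the tilted measure replaces the
estimate of a moment generating function. *)
Lemma gibbs_chernoff (H g : config n -> R) (theta r : R) : 0 <= theta ->
  gibbs_mean (fun x => H x + theta * g x) g <= - r ->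
  (\sum_(x | 0 <= g x) expR (H x)) / (\sum_x expR (H x)) <= expR (- (theta * r)).
Proof.
move=> th0 hr; apply: (@le_trans _ _ (gibbs_mean H (fun x => expR (theta * g x)))).
  rewrite ler_pM2r ?invr_gt0 ?partition_gt0// big_mkcond/=.
  apply: ler_sum => x _; case: ifP => gx; last by rewrite mulr_ge0 ?expR_ge0.
  by rewrite ler_peMr ?expR_ge0// -[1]expR0 ler_expR mulr_ge0.
apply: le_trans (tilted_jensen _ _ _) _.
by rewrite ler_expR -mulrN ler_wpM2l.
Qed.

End Gibbs.

(** * The Schur test *)

Section Schur.
Variables (R : realType) (n : nat).

Lemma row_cauchy_schwarz (b z : 'I_n -> R) (K : R) :
  \sum_j `|b j| <= K ->
  (\sum_j b j * z j) ^+ 2 <= K * \sum_j `|b j| * z j ^+ 2.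
Proof.
move=> bK.
have q0 : 0 <= \sum_j `|b j| * z j ^+ 2.
  by apply: sumr_ge0 => j _; rewrite mulr_ge0 ?sqr_ge0.
apply: (@le_trans _ _ ((\sum_j `|b j|) * \sum_j `|b j| * z j ^+ 2)); last first.
  by rewrite ler_wpM2r.
set a := \sum_j `|b j|; set q := \sum_j _ * z _ ^+ 2.
have : 2 * (\sum_j b j * z j) ^+ 2 <= a * q + q * a.
  rewrite expr2 /a /q !big_distrlr/= mulr_sumr -big_split/=.
  apply: ler_sum => j _; rewrite mulr_sumr -big_split/=; apply: ler_sum => k _.
  have h : b j * z j * (b k * z k) <= `|b j| * `|b k| * (`|z j| * `|z k|).
    by apply: le_trans (ler_norm _) _; rewrite !normrM mulrACA.
  have := sqr_ge0 (`|z j| - `|z k|); have := mulr_ge0 (normr_ge0 (b j)) (normr_ge0 (b k)).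
  rewrite -[z j ^+ 2]real_normK ?num_real// -[z k ^+ 2]real_normK ?num_real//.
  move: h; set P := _ * `|b k|; set X := `|z j|; set Y := `|z k| => h P0 XY.
  have -> : `|b j| * (`|b k| * Y ^+ 2) + `|b j| * X ^+ 2 * `|b k| = P * (Y ^+ 2 + X ^+ 2).
    by rewrite /P; ring.
  by nra.
by rewrite mulrC; lra.
Qed.

Lemma schur_test (b : 'I_n -> 'I_n -> R) (z : 'I_n -> R) (K : R) :
  (forall i, \sum_j `|b i j| <= K) -> (forall j, \sum_i `|b i j| <= K) ->
  \sum_i (\sum_j b i j * z j) ^+ 2 <= K ^+ 2 * \sum_j z j ^+ 2.
Proof.
move=> rowK colK.
apply: (@le_trans _ _ (\sum_i K * \sum_j `|b i j| * z j ^+ 2)).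
  by apply: ler_sum => i _; exact: row_cauchy_schwarz.
rewrite -mulr_sumr exchange_big/= !mulr_sumr; apply: ler_sum => j _.
have K0 : 0 <= K by apply: le_trans (colK j); exact: sumr_ge0.
by rewrite -mulr_suml expr2 -mulrA ler_wpM2l// ler_wpM2r ?sqr_ge0.
Qed.

End Schur.

(** * Drift of the gain under the tilted measure *)

Section Drift.
Variables (R : realType) (n : nat) (J A : 'M[R]_n) (B c theta : R).
Hypotheses (Jsym : forall i j, J i j = J j i) (Asym : forall i j, A i j = A j i).
Hypotheses (J0 : forall i, J i i = 0) (A0 : forall i, A i i = 0).
Hypotheses (B1 : 1 <= B).
Hypotheses (JB : forall i, \sum_j `|J i j| <= B).
Hypotheses (AB : forall i, \sum_j `|A i j| <= 2 * B).
Hypotheses (c0 : 0 <= c) (c1 : c <= 1) (theta0 : 0 < theta).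
Implicit Types (x : config n) (i j k : 'I_n).

Definition lin (C : 'M[R]_n) x i : R := \sum_j C i j * spin R x j.

Definition energy x : R := (\sum_i spin R x i * lin J x i) / 2.

(** The spin centred by its conditional mean under [J]. *)
Definition res x i : R := spin R x i - th (lin J x i).

(** The linear part of the gain of [J + A] over [J]: minus the derivative of the
negative log pseudo-likelihood at [J] in direction [A]. *)
Definition cross x : R := \sum_j lin A x j * res x j.

Definition sqlin x : R := \sum_j lin A x j ^+ 2.

Definition Ares x i : R := \sum_j A i j * res x j.

Definition sqres x : R := \sum_i Ares x i ^+ 2.

Definition sqfrob : R := \sum_i \sum_j A i j ^+ 2.

Definition gain x : R := cross x - c * sqlin x.

(** The influence of the [i]-th spin on the conditional mean of the [j]-th one. *)
Definition dth i j x : R := dif i (fun y => th (lin J y j)) x.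

Let B0 : 0 <= B. Proof. by have := B1; lra. Qed.

Lemma dif_lin (C : 'M[R]_n) i j x :
  dif i (fun y => lin C y j) x = C j i * spin R x i.
Proof.
rewrite /lin dif_sum (bigD1 i)//= big1 => [|k ki].
  by rewrite addr0 difZ dif_spin eqxx.
by rewrite difZ dif_spin (negbTE ki) mulr0.
Qed.

Lemma dif_energy i x : dif i energy x = spin R x i * lin J x i.
Proof.
have -> : dif i energy x = 2^-1 * dif i (fun y => \sum_k spin R y k * lin J y k) x.
  by rewrite -difZ; congr (dif _ _ _); apply: funext => y; rewrite mulrC.
rewrite dif_sum.
have E k : dif i (fun y => spin R y k * lin J y k) x =
    (if k == i then spin R x i * lin J x i else 0) + J i k * (spin R x i * spin R x k).
  rewrite difM dif_lin dif_spin; case: eqP => [->|_].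
    by rewrite J0; ring.
  by rewrite Jsym; ring.
under eq_bigr => k _ do rewrite E.
rewrite big_split/= -big_mkcond/= big_pred1_eq.
have -> : \sum_k J i k * (spin R x i * spin R x k) = spin R x i * lin J x i.
  by rewrite /lin mulr_sumr; apply: eq_bigr => k _; ring.
by field.
Qed.

Lemma dth_le i j x : `|dth i j x| <= 2 * `|J i j|.
Proof.
rewrite /dth /dif normrM normfV normr_nat ler_pdivrMr//.
apply: le_trans (th_lipschitz _ _) _.
have -> : lin J x j - lin J (flip i x) j = 2 * (J j i * spin R x i).
  by rewrite -dif_lin /dif; field.
rewrite !normrM normr_spin mulr1 Jsym normr_nat; lra.
Qed.

Lemma dif_res i j x : dif i (fun y => res y j) x =
  (if j == i then spin R x j else 0) - dth i j x.
Proof. by rewrite /res difB dif_spin. Qed.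

Lemma dif_cross i x : dif i cross x =
  spin R x i * (Ares x i + lin A x i) - \sum_j dth i j x * lin A x j
  + 2 * spin R x i * \sum_j dth i j x * A i j.
Proof.
rewrite /cross dif_sum.
have E j : dif i (fun y => lin A y j * res y j) x =
    spin R x i * (A i j * res x j) + (if j == i then spin R x i * lin A x i else 0)
    - dth i j x * lin A x j + 2 * spin R x i * (dth i j x * A i j).
  rewrite difM dif_lin dif_res; case: eqP => [->|_].
    by rewrite A0; ring.
  by rewrite Asym; ring.
under eq_bigr => j _ do rewrite E.
rewrite !big_split/= sumrN -!mulr_sumr -big_mkcond/= big_pred1_eq.
by rewrite -/(Ares x i) mulrDr.
Qed.

Lemma dif_sqlin i x : dif i sqlin x =
  2 * spin R x i * (\sum_j A i j * lin A x j) - 2 * \sum_j A i j ^+ 2.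
Proof.
rewrite /sqlin dif_sum.
have E j : dif i (fun y => lin A y j ^+ 2) x =
    2 * spin R x i * (A i j * lin A x j) - 2 * A i j ^+ 2.
  have -> : (fun y => lin A y j ^+ 2) = (fun y => lin A y j * lin A y j).
    by apply: funext => y; rewrite expr2.
  rewrite difM dif_lin Asym.
  have := spin2 R x i; set s := spin R x i => s2.
  have -> : A i j * s * (A i j * s) = A i j ^+ 2 * (s * s) by ring.
  by rewrite s2; ring.
under eq_bigr => j _ do rewrite E.
by rewrite big_split/= sumrN -!mulr_sumr.
Qed.

Lemma sum_A_op (z : 'I_n -> R) :
  \sum_i (\sum_j A i j * z j) ^+ 2 <= 4 * B ^+ 2 * \sum_j z j ^+ 2.
Proof.
have -> : 4 * B ^+ 2 = (2 * B) ^+ 2 by ring.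
apply: schur_test => // j.
by under eq_bigr => i _ do rewrite Asym; exact: AB.
Qed.

Lemma A_le i j : `|A i j| <= 2 * B.
Proof. by apply: le_trans (AB i); rewrite (bigD1 j)//= lerDl sumr_ge0. Qed.

Lemma J_le i j : `|J i j| <= B.
Proof. by apply: le_trans (JB i); rewrite (bigD1 j)//= lerDl sumr_ge0. Qed.

Lemma row_sq_le i : \sum_j A i j ^+ 2 <= 4 * B ^+ 2.
Proof.
apply: (@le_trans _ _ (\sum_j (2 * B) * `|A i j|)).
  apply: ler_sum => j _; rewrite -real_normK ?num_real// expr2.
  by rewrite ler_wpM2r ?A_le.
rewrite -mulr_sumr; have := AB i; have := B0; nra.
Qed.

Lemma row_sq_ge0 i : 0 <= \sum_j A i j ^+ 2.
Proof. by apply: sumr_ge0 => j _; exact: sqr_ge0. Qed.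

Lemma sum_row_sq_le :
  \sum_i (\sum_j A i j ^+ 2) ^+ 2 <= 4 * B ^+ 2 * sqfrob.
Proof.
rewrite /sqfrob mulr_sumr; apply: ler_sum => i _.
by rewrite expr2 ler_wpM2r ?row_sq_le ?row_sq_ge0.
Qed.

Lemma dth_row i x : \sum_j `|dth i j x| <= 2 * B.
Proof.
apply: (@le_trans _ _ (\sum_j 2 * `|J i j|)).
  by apply: ler_sum => j _; exact: dth_le.
by rewrite -mulr_sumr ler_pM2l.
Qed.

Lemma dth_col j x : \sum_i `|dth i j x| <= 2 * B.
Proof.
apply: (@le_trans _ _ (\sum_i 2 * `|J j i|)).
  by apply: ler_sum => i _; rewrite Jsym; exact: dth_le.
by rewrite -mulr_sumr ler_pM2l.
Qed.

(** The common yardstick of all the error terms: each of them is at most a small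
multiple of its tilted average. *)
Definition scale x : R := sqlin x + sqres x + sqfrob.

Lemma sqlin_ge0 x : 0 <= sqlin x.
Proof. by apply: sumr_ge0 => i _; exact: sqr_ge0. Qed.

Lemma sqres_ge0 x : 0 <= sqres x.
Proof. by apply: sumr_ge0 => i _; exact: sqr_ge0. Qed.

Lemma sqfrob_ge0 : 0 <= sqfrob.
Proof. by apply: sumr_ge0 => i _; exact: row_sq_ge0. Qed.

Lemma sqrD6_le (a b d e f g : R) : (a + b + d + e + f + g) ^+ 2 <=
  6 * (a ^+ 2 + b ^+ 2 + d ^+ 2 + e ^+ 2 + f ^+ 2 + g ^+ 2).
Proof.
have h2 (u v : R) : (u + v) ^+ 2 <= 2 * (u ^+ 2 + v ^+ 2).
  by have := sqr_ge0 (u - v); nra.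
have h3 (u v w : R) : (u + v + w) ^+ 2 <= 3 * (u ^+ 2 + v ^+ 2 + w ^+ 2).
  by have := sqr_ge0 (u - v); have := sqr_ge0 (u - w); have := sqr_ge0 (v - w); nra.
have := h3 (a + b) (d + e) (f + g).
have := h2 a b; have := h2 d e; have := h2 f g.
by rewrite !addrA; lra.
Qed.

(** Six terms arise from the Leibniz rule. Those that carry [lin A] or [Ares]
are controlled by operator norms through the Schur test, the second-order ones by
row sums of squares, hence by the Frobenius norm. *)
Lemma sum_dif_gain_sq x : \sum_i dif i gain x ^+ 2 <= 192 * B ^+ 2 * scale x.
Proof.
set P3 := fun i => \sum_j dth i j x * lin A x j.
set P4 := fun i => \sum_j dth i j x * A i j.
set P5 := fun i => \sum_j A i j * lin A x j.
set P6 := fun i => \sum_j A i j ^+ 2.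
have b3 : \sum_i P3 i ^+ 2 <= 4 * B ^+ 2 * sqlin x.
  have -> : 4 * B ^+ 2 = (2 * B) ^+ 2 by ring.
  by apply: schur_test => i; [exact: dth_row|exact: dth_col].
have b4 : \sum_i P4 i ^+ 2 <= 4 * B ^+ 2 * sqfrob.
  rewrite /sqfrob mulr_sumr; apply: ler_sum => i _.
  apply: le_trans (row_cauchy_schwarz _ (dth_row i x)) _.
  have -> : 4 * B ^+ 2 = (2 * B) * (2 * B) by ring.
  rewrite -[leRHS]mulrA ler_wpM2l ?mulr_ge0// mulr_sumr; apply: ler_sum => j _.
  rewrite ler_wpM2r ?sqr_ge0//; apply: le_trans (dth_le _ _ _) _.
  by rewrite ler_pM2l// J_le.
have b5 : \sum_i P5 i ^+ 2 <= 4 * B ^+ 2 * sqlin x by exact: sum_A_op.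
have b6 : \sum_i P6 i ^+ 2 <= 4 * B ^+ 2 * sqfrob by exact: sum_row_sq_le.
have step i : dif i gain x ^+ 2 <=
   6 * (Ares x i ^+ 2 + lin A x i ^+ 2 + P3 i ^+ 2 + 4 * P4 i ^+ 2
        + 4 * P5 i ^+ 2 + 4 * P6 i ^+ 2).
  rewrite /gain difB difZ dif_cross dif_sqlin -/(P3 i) -/(P4 i) -/(P5 i) -/(P6 i).
  have := spin2 R x i; set s := spin R x i => s2.
  have cc : c ^+ 2 <= 1 by have := c0; have := c1; nra.
  have := sqrD6_le (s * Ares x i) (s * lin A x i) (- P3 i) (2 * s * P4 i)
      (- (c * (2 * s * P5 i))) (c * (2 * P6 i)).
  have -> : s * Ares x i + s * lin A x i + - P3 i + 2 * s * P4 i +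
      - (c * (2 * s * P5 i)) + c * (2 * P6 i) =
    s * (Ares x i + lin A x i) - P3 i + 2 * s * P4 i
      - c * (2 * s * P5 i - 2 * P6 i) by ring.
  move=> /le_trans; apply; rewrite ler_pM2l//.
  have sq (a : R) : (s * a) ^+ 2 = a ^+ 2 by rewrite exprMn expr2 s2 mul1r.
  have -> : 2 * s * P4 i = s * (2 * P4 i) by ring.
  have -> : c * (2 * s * P5 i) = s * (c * (2 * P5 i)) by ring.
  rewrite !sqrrN !sq !exprMn.
  have := sqr_ge0 (P5 i); have := sqr_ge0 (P6 i).
  by set u := P5 i ^+ 2; set v := P6 i ^+ 2; nra.
apply: le_trans (ler_sum _ (fun i _ => step i)) _.
rewrite -mulr_sumr !big_split/= -!mulr_sumr.
rewrite -/(sqres x) -/(sqlin x) /scale.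
move: b3 b4 b5 b6 (sqlin_ge0 x) (sqres_ge0 x) sqfrob_ge0.
set s3 := \sum_i P3 i ^+ 2; set s4 := \sum_i P4 i ^+ 2.
set s5 := \sum_i P5 i ^+ 2; set s6 := \sum_i P6 i ^+ 2.
set u := sqlin x; set v := sqres x; set s := sqfrob.
have : 1 <= B ^+ 2 by have := B1; nra.
set b := B ^+ 2 => b1 b3 b4 b5 b6 u0 v0 s0.
have : u <= b * u by nra.
have : v <= b * v by nra.
have : 0 <= b * v by nra.
have : 0 <= b * u by nra.
have : 0 <= b * s by nra.
nra.
Qed.

Definition tilted x : R := energy x + theta * gain x.

(** The conditional mean of the [i]-th spin under the tilted measure. *)
Definition cmean x i : R := th (spin R x i * dif i tilted x).

(** The shift of the conditional mean caused by the tilt. *)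
Definition tau x i : R := cmean x i - th (lin J x i).

Lemma tau_le x i : `|tau x i| <= 2 * (theta * `|dif i gain x|).
Proof.
rewrite /tau /cmean /tilted difD difZ dif_energy mulrDr mulrA spin2 mul1r.
apply: le_trans (th_lipschitz _ _) _.
by rewrite addrAC subrr add0r !normrM normr_spin mul1r (gtr0_norm theta0).
Qed.

Lemma sum_tau_sq x : \sum_i tau x i ^+ 2 <= 768 * B ^+ 2 * theta ^+ 2 * scale x.
Proof.
apply: (@le_trans _ _ (\sum_i 4 * theta ^+ 2 * dif i gain x ^+ 2)).
  apply: ler_sum => i _; rewrite -real_normK ?num_real//.
  rewrite -[dif i gain x ^+ 2]real_normK ?num_real//.
  have -> : 4 * theta ^+ 2 * `|dif i gain x| ^+ 2 =
    (2 * (theta * `|dif i gain x|)) ^+ 2 by ring.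
  by rewrite ler_pXn2r ?nnegrE ?mulr_ge0 ?(ltW theta0)// tau_le.
rewrite -mulr_sumr.
have -> : 768 * B ^+ 2 * theta ^+ 2 * scale x =
  4 * theta ^+ 2 * (192 * B ^+ 2 * scale x) by ring.
by rewrite ler_wpM2l ?sum_dif_gain_sq// mulr_ge0 ?sqr_ge0.
Qed.

(** The relative size of the perturbation errors; 800 dominates twice the constant
386 that comes out of [slack_pairing]. *)
Definition slack : R := 800 * B ^+ 2 * theta.

(** Cauchy-Schwarz in the form [p tau <= theta p^2 / 2 + tau^2 / (2 theta)]:
since [tau] is of order [theta], both terms are of order [theta]. *)
Lemma slack_pairing (p : 'I_n -> R) x :
  \sum_i p i ^+ 2 <= 4 * B ^+ 2 * scale x ->
  `|\sum_i p i * tau x i| <= slack / 2 * scale x.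
Proof.
move=> hp.
have W0 : 0 <= scale x by rewrite !addr_ge0 ?sqlin_ge0 ?sqres_ge0 ?sqfrob_ge0.
have half i : `|p i * tau x i| <= theta / 2 * p i ^+ 2 + (2 * theta)^-1 * tau x i ^+ 2.
  rewrite -[p i ^+ 2]real_normK ?num_real// -[tau x i ^+ 2]real_normK ?num_real// normrM.
  set a := `|p i|; set b := `|tau x i|.
  have := mulr_ge0 (ltW (_ : 0 < (2 * theta)^-1)) (sqr_ge0 (theta * a - b)).
  rewrite invr_gt0 mulr_gt0// => /(_ isT).
  have -> : (2 * theta)^-1 * (theta * a - b) ^+ 2 =
     theta / 2 * a ^+ 2 + (2 * theta)^-1 * b ^+ 2 - a * b.
    by field; rewrite gt_eqF.
  by rewrite subr_ge0.
apply: le_trans (ler_norm_sum _ _ _) _.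
apply: le_trans (ler_sum _ (fun i _ => half i)) _.
rewrite big_split/= -!mulr_sumr.
have h1 : theta / 2 * \sum_i p i ^+ 2 <= theta / 2 * (4 * B ^+ 2 * scale x).
  by rewrite ler_pM2l// divr_gt0.
have h2 : (2 * theta)^-1 * \sum_i tau x i ^+ 2 <= 384 * B ^+ 2 * theta * scale x.
  apply: (@le_trans _ _ ((2 * theta)^-1 * (768 * B ^+ 2 * theta ^+ 2 * scale x))).
    by rewrite ler_pM2l ?sum_tau_sq// invr_gt0 mulr_gt0.
  by rewrite le_eqVlt; apply/orP; left; apply/eqP; field; rewrite gt_eqF.
apply: le_trans (lerD h1 h2) _.
have : 0 <= B ^+ 2 * theta * scale x by rewrite !mulr_ge0// ltW.
by rewrite /slack; lra.
Qed.

Let e := gibbs_mean tilted.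

Lemma stein_tilted i (h : config n -> R) :
  e (fun x => h x * (spin R x i - cmean x i)) =
  e (fun x => dif i h x * (spin R x i - cmean x i)).
Proof. exact: stein. Qed.

Lemma mean_scale : e scale = e sqlin + e sqres + sqfrob.
Proof. by rewrite /e /scale !gibbs_meanD gibbs_mean_cst. Qed.

Lemma res_split x i : res x i = (spin R x i - cmean x i) + tau x i.
Proof. by rewrite /res /tau; ring. Qed.

Lemma mean_pairing_le (p : config n -> 'I_n -> R) :
  (forall x, \sum_i p x i ^+ 2 <= 4 * B ^+ 2 * scale x) ->
  `|e (fun x => \sum_i p x i * tau x i)| <= slack / 2 * (e sqlin + e sqres + sqfrob).
Proof.
move=> hp; rewrite -mean_scale -gibbs_meanZ ler_norml; apply/andP; split.
  rewrite -[X in - X]mul1r -mulNr -gibbs_meanZ; apply: le_gibbs_mean => x.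
  by rewrite mulN1r; have := slack_pairing (hp x); rewrite ler_norml => /andP[].
by apply: le_gibbs_mean => x; have := slack_pairing (hp x); rewrite ler_norml => /andP[].
Qed.

Let lin_pairing_le x : \sum_i lin A x i ^+ 2 <= 4 * B ^+ 2 * scale x.
Proof.
rewrite -/(sqlin x) /scale.
have := sqlin_ge0 x; have := sqres_ge0 x; have := sqfrob_ge0.
set u := sqlin x; set v := sqres x; set s := sqfrob => s0 v0 u0.
have b1 : 1 <= 4 * B ^+ 2 by have := B1; nra.
by apply: (@le_trans _ _ (u + v + s)); [lra|rewrite ler_peMl//; lra].
Qed.

(** [lin A x i] does not depend on the [i]-th spin, so only the shift [tau]
contributes. *)
Lemma mean_cross_le :
  e cross <= slack / 2 * (e sqlin + e sqres + sqfrob).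
Proof.
have -> : e cross = e (fun x => \sum_i lin A x i * tau x i).
  have -> : e cross = e (fun x => \sum_i lin A x i * (spin R x i - cmean x i)
                              + \sum_i lin A x i * tau x i).
    apply: eq_gibbs_mean => x; rewrite -big_split/=; apply: eq_bigr => i _.
    by rewrite -mulrDr -res_split.
  rewrite /e gibbs_meanD gibbs_mean_sum big1 ?add0r// => i _.
  rewrite -/e stein_tilted -(gibbs_mean_cst tilted 0).
  by apply: eq_gibbs_mean => x; rewrite dif_lin A0 !mul0r.
by apply: le_trans (ler_norm _) _; exact: (mean_pairing_le lin_pairing_le).
Qed.

Lemma normr_residual_le2 x i : `|spin R x i - cmean x i| <= 2.
Proof.
apply: le_trans (ler_normB _ _) _.
by rewrite normr_spin; have := normr_th_le1 (spin R x i * dif i tilted x); rewrite /cmean; lra.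
Qed.

Let A_pairing_le (z : config n -> 'I_n -> R) :
  (forall x, \sum_i z x i ^+ 2 <= scale x) ->
  forall x, \sum_j (\sum_i A j i * z x i) ^+ 2 <= 4 * B ^+ 2 * scale x.
Proof.
move=> hz x; apply: le_trans (sum_A_op _) _.
by rewrite ler_wpM2l// mulr_ge0 ?sqr_ge0.
Qed.

Let sqlin_le_scale x : \sum_i lin A x i ^+ 2 <= scale x.
Proof.
by rewrite -/(sqlin x) /scale; have := sqres_ge0 x; have := sqfrob_ge0; lra.
Qed.

Let sqres_le_scale x : \sum_i Ares x i ^+ 2 <= scale x.
Proof.
by rewrite -/(sqres x) /scale; have := sqlin_ge0 x; have := sqfrob_ge0; lra.
Qed.

Lemma dif_Ares j i x :
  dif j (Ares^~ i) x = A i j * spin R x j - \sum_k A i k * dth j k x.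
Proof.
rewrite /Ares dif_sum.
have E k : dif j (fun y => A i k * res y k) x =
    (if k == j then A i j * spin R x j else 0) - A i k * dth j k x.
  by rewrite difZ dif_res; case: eqP => [->|_]; ring.
under eq_bigr => k _ do rewrite E.
by rewrite big_split/= sumrN -big_mkcond/= big_pred1_eq.
Qed.

(** Split the product of the two entries of [A] by the arithmetic-geometric mean
inequality and sum the influences along rows or columns. *)
Lemma sum_AAdth_le x :
  \sum_j \sum_i `|A i j| * \sum_k `|A i k| * `|dth j k x| <= 2 * B * sqfrob.
Proof.
pose S1 := \sum_j \sum_i \sum_k (A i j ^+ 2 * `|dth j k x|).
pose S2 := \sum_j \sum_i \sum_k (A i k ^+ 2 * `|dth j k x|).
have h1 : S1 <= 2 * B * sqfrob.
  rewrite /S1 /sqfrob [in leRHS]exchange_big/= mulr_sumr; apply: ler_sum => j _.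
  rewrite mulr_sumr; apply: ler_sum => i _.
  by rewrite -mulr_sumr mulrC ler_wpM2r ?sqr_ge0 ?dth_row.
have h2 : S2 <= 2 * B * sqfrob.
  rewrite /S2 /sqfrob exchange_big/= mulr_sumr; apply: ler_sum => i _.
  rewrite exchange_big/= mulr_sumr; apply: ler_sum => k _.
  by rewrite -mulr_sumr mulrC ler_wpM2r ?sqr_ge0 ?dth_col.
suff : 2 * (\sum_j \sum_i `|A i j| * \sum_k `|A i k| * `|dth j k x|) <= S1 + S2 by lra.
rewrite /S1 /S2 mulr_sumr -big_split/=; apply: ler_sum => j _.
rewrite mulr_sumr -big_split/=; apply: ler_sum => i _.
rewrite !mulr_sumr -big_split/=; apply: ler_sum => k _.
rewrite -[A i j ^+ 2]real_normK ?num_real// -[A i k ^+ 2]real_normK ?num_real//.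
have := mulr_ge0 (normr_ge0 (dth j k x)) (sqr_ge0 (`|A i j| - `|A i k|)).
by set a := `|A i j|; set b := `|A i k|; set d := `|dth j k x|; nra.
Qed.

(** Expand one factor of the square and apply Stein's identity to the other: the
discrete derivative of [Ares] is of the order of the entries of [A], which turns
the sum into a squared Frobenius norm. *)
Lemma mean_sqres_le :
  e sqres <= 6 * B * sqfrob + slack / 2 * (e sqlin + e sqres + sqfrob).
Proof.
have sqresE : e sqres =
    e (fun x => \sum_j \sum_i dif j (Ares^~ i) x * A i j * (spin R x j - cmean x j))
  + e (fun x => \sum_j (\sum_i A j i * Ares x i) * tau x j).
  transitivity (e (fun x => \sum_j (\sum_i A j i * Ares x i) * (spin R x j - cmean x j)
      + \sum_j (\sum_i A j i * Ares x i) * tau x j)).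
    apply: eq_gibbs_mean => x; rewrite -big_split/=.
    under [RHS]eq_bigr => j _ do rewrite -mulrDr -res_split mulr_suml.
    rewrite exchange_big/=; apply: eq_bigr => i _.
    rewrite expr2 {1}/Ares mulr_suml; apply: eq_bigr => j _.
    by rewrite Asym mulrAC.
  rewrite /e gibbs_meanD; congr (_ + _).
  rewrite !gibbs_mean_sum; apply: eq_bigr => j _.
  transitivity (e (fun x => \sum_i A i j * (Ares x i * (spin R x j - cmean x j)))).
    apply: eq_gibbs_mean => x; rewrite mulr_suml; apply: eq_bigr => i _.
    by rewrite Asym mulrA.
  rewrite /e !gibbs_mean_sum; apply: eq_bigr => i _.
  rewrite gibbs_meanZ -/e stein_tilted -gibbs_meanZ.
  by apply: eq_gibbs_mean => x; rewrite mulrA (mulrC (A i j)).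
rewrite [leLHS]sqresE; apply: lerD; last first.
  apply: le_trans (ler_norm _) _.
  by apply: (@mean_pairing_le (fun x j => \sum_i A j i * Ares x i));
    exact: (A_pairing_le sqres_le_scale).
rewrite -(gibbs_mean_cst tilted (6 * B * sqfrob)); apply: le_gibbs_mean => x.
apply: (@le_trans _ _ (\sum_j \sum_i (2 * (A i j ^+ 2 +
      `|A i j| * \sum_k `|A i k| * `|dth j k x|)))).
  apply: ler_sum => j _; apply: ler_sum => i _.
  have : `|dif j (Ares^~ i) x| <= `|A i j| + \sum_k `|A i k| * `|dth j k x|.
    rewrite dif_Ares; apply: le_trans (ler_normB _ _) _.
    rewrite normrM normr_spin mulr1 lerD2l.
    apply: le_trans (ler_norm_sum _ _ _) _.
    by apply: ler_sum => k _; rewrite normrM.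
  move: (dif j _ x) => D hD.
  apply: le_trans (ler_norm _) _; rewrite !normrM [leLHS]mulrC.
  apply: ler_pM => //; rewrite ?mulr_ge0 ?normr_residual_le2//.
  by rewrite mulrC -[A i j ^+ 2]real_normK ?num_real// expr2 -mulrDr ler_wpM2l.
under eq_bigr => j _ do rewrite -mulr_sumr big_split/=.
rewrite -mulr_sumr big_split/= [X in X + _]exchange_big/= -/sqfrob.
have := sum_AAdth_le x; have := mulr_ge0 (_ : 0 <= B - 1) sqfrob_ge0.
by rewrite subr_ge0 => /(_ B1); lra.
Qed.

Definition colsq j : R := \sum_i A j i ^+ 2.

Lemma colsq_pairing_le x :
  \sum_j (colsq j * spin R x j) ^+ 2 <= 4 * B ^+ 2 * scale x.
Proof.
apply: (@le_trans _ _ (4 * B ^+ 2 * sqfrob)).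
  apply: le_trans sum_row_sq_le; apply: ler_sum => j _.
  by rewrite exprMn sqr_spin mulr1.
rewrite ler_wpM2l ?mulr_ge0 ?sqr_ge0//.
by rewrite /scale; have := sqlin_ge0 x; have := sqres_ge0 x; lra.
Qed.

(** Stein's identity applied to [lin A x i] picks out the entry [A i j] times the
conditional variance of the [j]-th spin, which is at least [gap]. *)
Lemma frob_le_mean (gap : R) :
  (forall x i, gap <= 1 - `|th (lin J x i)|) ->
  gap * sqfrob <= e (fun x => \sum_i lin A x i * Ares x i)
                  + slack * (e sqlin + e sqres + sqfrob).
Proof.
move=> hgap.
have pt x : gap * sqfrob <= \sum_j colsq j * spin R x j * res x j.
  rewrite /sqfrob mulr_sumr; apply: ler_sum => j _.
  rewrite mulrC -mulrA ler_wpM2l ?row_sq_ge0//.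
  apply: le_trans (hgap x j) _; rewrite /res mulrBr spin2 lerD2l lerN2.
  by apply: le_trans (ler_norm _) _; rewrite normrM normr_spin mul1r.
apply: (@le_trans _ _ (e (fun x => \sum_j colsq j * spin R x j * res x j))).
  by rewrite -[leLHS](gibbs_mean_cst tilted); exact: le_gibbs_mean.
(* Both sides are sums of [A j i] times a Stein pairing with the [j]-th centred
   spin; the two functions paired have the same discrete derivative. *)
have st : e (fun x => \sum_j colsq j * spin R x j * (spin R x j - cmean x j)) =
    e (fun x => \sum_j (\sum_i A j i * lin A x i) * (spin R x j - cmean x j)).
  rewrite /e !gibbs_mean_sum; apply: eq_bigr => j _.
  transitivity (e (fun x => \sum_i A j i * (lin A x i * (spin R x j - cmean x j)))).
    rewrite /e gibbs_mean_sum.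
    under [RHS]eq_bigr => i _ do rewrite gibbs_meanZ -/e stein_tilted -gibbs_meanZ.
    rewrite -gibbs_mean_sum; apply: eq_gibbs_mean => x.
    rewrite /colsq !mulr_suml; apply: eq_bigr => i _.
    by rewrite dif_lin (Asym i j) expr2 !mulrA.
  apply: eq_gibbs_mean => x; rewrite mulr_suml; apply: eq_bigr => i _.
  by rewrite mulrA.
have s1 : e (fun x => \sum_j colsq j * spin R x j * res x j) =
    e (fun x => \sum_j colsq j * spin R x j * (spin R x j - cmean x j))
  + e (fun x => \sum_j colsq j * spin R x j * tau x j).
  rewrite /e -gibbs_meanD; apply: eq_gibbs_mean => x.
  by rewrite -big_split/=; apply: eq_bigr => j _; rewrite -mulrDr -res_split.
have s2 : e (fun x => \sum_i lin A x i * Ares x i) =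
    e (fun x => \sum_j (\sum_i A j i * lin A x i) * (spin R x j - cmean x j))
  + e (fun x => \sum_j (\sum_i A j i * lin A x i) * tau x j).
  rewrite /e -gibbs_meanD; apply: eq_gibbs_mean => x.
  rewrite -big_split/=.
  under [RHS]eq_bigr => j _ do rewrite -mulrDr -res_split mulr_suml.
  rewrite exchange_big/=; apply: eq_bigr => i _.
  by rewrite /Ares mulr_sumr; apply: eq_bigr => j _; rewrite (Asym i j); ring.
have t1 := @mean_pairing_le (fun x j => colsq j * spin R x j) colsq_pairing_le.
have t2 := @mean_pairing_le (fun x j => \sum_i A j i * lin A x i) (A_pairing_le sqlin_le_scale).
move: t1 t2; rewrite !ler_norml => /andP[_ t1] /andP[t2 _].
by rewrite s1 st s2; lra.
Qed.

(** The free parameter balances [sqlin], to be bounded below, against [sqres],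
already bounded above. *)
Lemma mean_dot_le (eta : R) : 0 < eta ->
  e (fun x => \sum_i lin A x i * Ares x i) <= (eta^-1 * e sqlin + eta * e sqres) / 2.
Proof.
move=> eta0; rewrite -(gibbs_meanZ _ eta^-1) -(gibbs_meanZ _ eta) -gibbs_meanD.
rewrite mulrC -gibbs_meanZ; apply: le_gibbs_mean => x.
rewrite /sqlin /sqres !mulr_sumr -big_split/= mulr_sumr; apply: ler_sum => i _.
set a := lin A x i; set b := Ares x i.
have := mulr_ge0 (ltW (_ : 0 < eta^-1)) (sqr_ge0 (a - eta * b)).
rewrite invr_gt0 => /(_ eta0).
have -> : eta^-1 * (a - eta * b) ^+ 2 = eta^-1 * a ^+ 2 + eta * b ^+ 2 - 2 * (a * b).
  by field; rewrite gt_eqF.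
lra.
Qed.

End Drift.

(** * Choice of the constants *)

(** Here [B = expR M], [ep = expR (- M)], and [u], [v], [S], [f] stand for the
tilted averages of [sqlin], [sqres], [sqfrob] and [cross]. The upper bound on [v]
leaves [v <= 8 B S + u / 7]. The third hypothesis then gives
[ep^5 S <= 20 u], so that [ep^4 u / 8] exceeds the error terms, which are of order
[om B S] with [om B] as small as [ep^9]. *)
Lemma drift_arithmetic (R : realType) (B ep u v S om f : R) :
  1 <= B -> ep * B = 1 -> 0 <= u -> 0 <= v -> 0 <= S -> om = ep ^+ 10 / 80 ^+ 2 ->
  v <= 6 * B * S + om / 2 * (u + v + S) ->
  ep ^+ 2 * S <= ((ep ^+ 3 / 16)^-1 * u + ep ^+ 3 / 16 * v) / 2 + om * (u + v + S) ->
  f <= om / 2 * (u + v + S) ->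
  f - ep ^+ 4 / 8 * u <= - (ep ^+ 9 * S / 800).
Proof.
move=> B1 epB u0 v0 S0 omE hv hS hf.
have ep0 : 0 < ep by rewrite -(pmulr_lgt0 ep (_ : 0 < B)) ?epB//; lra.
have ep1 : ep <= 1 by rewrite -epB ler_peMr// ltW.
have powle k : ep ^+ k <= 1 by rewrite exprn_ile1// ltW.
have pow0 k : 0 < ep ^+ k by exact: exprn_gt0.
have powD k l : ep ^+ (k + l) <= ep ^+ k.
  by rewrite exprD ler_piMr// ltW.
have omE' : om = ep ^+ 10 / 80 / 80 by rewrite omE; field.
have om0 : 0 < om by rewrite omE' !divr_gt0.
have om3 : om <= ep ^+ 3 / 100 by rewrite omE'; have := powD 3 7; lra.
have om4 : om <= ep ^+ 4 / 32 by rewrite omE'; have := powD 4 6; lra.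
have om1 : om <= 1 / 100 by have := powle 3; lra.
have BS0 : S <= B * S by nra.
have vle : v <= 8 * B * S + u / 7.
  have : om / 2 * (u + v + S) <= (u + v + S) / 8 by nra.
  lra.
have Wle : u + v + S <= 2 * u + 9 * (B * S) by lra.
have e2E : ep ^+ 3 * (B * S) = ep ^+ 2 * S.
  have -> : ep ^+ 3 * (B * S) = ep ^+ 2 * (ep * B) * S by ring.
  by rewrite epB mulr1.
have oW : om * (u + v + S) <= u / 50 + 9 / 100 * (ep ^+ 2 * S).
  apply: (@le_trans _ _ (om * (2 * u + 9 * (B * S)))); first by rewrite ler_pM2l.
  have : om * u <= u / 100 by nra.
  have : om * (B * S) <= ep ^+ 3 / 100 * (B * S) by rewrite ler_wpM2r//; lra.
  rewrite [ep ^+ 3 / 100 * _]mulrAC e2E; lra.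
have etav : ep ^+ 3 / 16 * v <= ep ^+ 2 * S / 2 + u / 100.
  apply: (@le_trans _ _ (ep ^+ 3 / 16 * (8 * B * S + u / 7))).
    by rewrite ler_pM2l// divr_gt0.
  have -> : ep ^+ 3 / 16 * (8 * B * S + u / 7) = ep ^+ 3 * (B * S) / 2 + ep ^+ 3 * u / 112.
    by field.
  rewrite e2E; have : ep ^+ 3 * u <= u by rewrite ler_piMl.
  lra.
have B3 : (ep ^+ 3 / 16)^-1 = 16 * B ^+ 3.
  apply: (@mulfI _ (ep ^+ 3 / 16)); first by rewrite gt_eqF// divr_gt0.
  rewrite mulfV ?gt_eqF ?divr_gt0//.
  have -> : ep ^+ 3 / 16 * (16 * B ^+ 3) = (ep * B) ^+ 3 by field.
  by rewrite epB expr1n.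
rewrite B3 in hS.
have B31 : u <= B ^+ 3 * u by rewrite ler_peMl// exprn_ege1.
have h5 : ep ^+ 2 * S <= 20 * (B ^+ 3 * u) by lra.
have u_ge : ep ^+ 9 * S <= 20 * (ep ^+ 4 * u).
  have -> : ep ^+ 9 * S = ep ^+ 7 * (ep ^+ 2 * S) by rewrite mulrA -exprD.
  apply: (@le_trans _ _ (ep ^+ 7 * (20 * (B ^+ 3 * u)))); first by rewrite ler_pM2l.
  rewrite le_eqVlt; apply/orP; left; apply/eqP.
  have -> : ep ^+ 7 * (20 * (B ^+ 3 * u)) = 20 * (ep ^+ 4 * (ep * B) ^+ 3 * u) by ring.
  by rewrite epB expr1n mulr1.
have omu : om * u <= ep ^+ 4 / 32 * u by rewrite ler_wpM2r.
have omBS : om * (B * S) = ep ^+ 9 * S / 80 ^+ 2.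
  rewrite omE.
  have -> : ep ^+ 10 / 80 ^+ 2 * (B * S) = ep ^+ 9 * (ep * B) * S / 80 ^+ 2 by field.
  by rewrite epB mulr1.
have : om / 2 * (u + v + S) <= om * u + 9 / 2 * (om * (B * S)).
  have : om * (u + v + S) <= om * (2 * u + 9 * (B * S)) by rewrite ler_pM2l.
  lra.
have := mulr_ge0 (ltW (pow0 9%N)) S0.
lra.
Qed.

(** * The pseudo-likelihood of an Ising model *)

Section PseudoLikelihood.
Variables (R : realType) (n : nat).
Implicit Types (x y : config n) (i j : 'I_n) (J K : 'M[R]_n).

Lemma interaction_sym J : interaction_matrix J -> forall i j, J i j = J j i.
Proof. by move=> [JT _] i j; rewrite -{1}JT mxE. Qed.

Lemma infty_norm_row J M : infty_norm J <= M -> forall i, \sum_j `|J i j| <= M.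
Proof.
move=> JM i; apply: le_trans JM.
exact: (le_bigmax 0 (fun i => \sum_j `|J i j|)).
Qed.

Lemma ising_weightE J x : ising_weight J x = expR (energy J x).
Proof.
rewrite /ising_weight /energy; congr (expR (_ / 2)).
rewrite !mxE; under eq_bigr => j _ do rewrite !mxE mulr_suml.
rewrite exchange_big/=; apply: eq_bigr => i _.
rewrite /lin mulr_sumr; apply: eq_bigr => j _.
by rewrite !mxE /spin mulrA.
Qed.

Lemma isingE J x : ising J x = expR (energy J x) / \sum_y expR (energy J y).
Proof.
by rewrite /ising ising_weightE; congr (_ / _); apply: eq_bigr => y _; rewrite ising_weightE.
Qed.

Lemma ising_ge0 J x : 0 <= ising J x.
Proof. by rewrite isingE divr_ge0 ?expR_ge0// ltW// partition_gt0. Qed.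

Lemma sum_ising J : \sum_x ising J x = 1.
Proof.
under eq_bigr => x _ do rewrite isingE.
by rewrite -mulr_suml mulfV// gt_eqF// partition_gt0.
Qed.

(** Two configurations that agree away from [i] are equal or differ by a flip. *)
Lemma agree_off i x y :
  [forall j, (j != i) ==> (y j == x j)] = (y == x) || (y == flip i x).
Proof.
apply/forallP/orP => [h|[]/eqP -> j].
- have yx j : j != i -> y j = x j by move=> ji; have := h j; rewrite ji => /eqP.
  have [yi|yi] := eqVneq (y i) (x i); [left|right]; apply/eqP/ffunP => j.
    by have [->//|/yx] := eqVneq j i.
  rewrite ffunE; have [->|/yx//] := eqVneq j i.
  by move: yi; case: (y i); case: (x i).
- by rewrite eqxx implybT.
- by rewrite ffunE; case: eqP => //=; rewrite eqxx.
Qed.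

Lemma flip_neq i x : flip i x != x.
Proof. by apply/eqP => /ffunP/(_ i); rewrite ffunE eqxx; case: (x i). Qed.

(** The conditioning event consists of [x] and its flip at [i]. *)
Lemma ising_condE J x i : interaction_matrix J ->
  ising_cond J x i = (1 + expR (- (2 * (spin R x i * lin J x i))))^-1.
Proof.
move=> iJ; have Jsym := interaction_sym iJ; have J0 := iJ.2.
rewrite /ising_cond /ising_prob.
have -> : \sum_(y | [pred y : config n | [forall j, (j != i) ==> (y j == x j)]] y) ising J y
    = ising J x + ising J (flip i x).
  rewrite (bigD1 x)/=; last by rewrite agree_off eqxx.
  congr (_ + _); rewrite (big_pred1 (flip i x))// => y /=.
  rewrite agree_off; have [->/=|] := eqVneq y x; last by rewrite andbT.
  by rewrite eq_sym (negbTE (flip_neq i x)).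
rewrite !isingE.
have -> : expR (energy J (flip i x)) =
    expR (energy J x) * expR (- (2 * (spin R x i * lin J x i))).
  by rewrite -expRD -dif_energy// /dif; congr expR; field.
have := partition_gt0 (energy J); set Z := \sum_y _ => Z0.
have := expR_gt0 (energy J x); set a := expR _ => a0.
have := expR_gt0 (- (2 * (spin R x i * lin J x i))); set b := expR _ => b0.
by field; rewrite !gt_eqF// ?addr_gt0// mulr_gt0.
Qed.

Lemma neg_log_plE J x : interaction_matrix J ->
  neg_log_pl x J = \sum_i ln (1 + expR (- (2 * (spin R x i * lin J x i)))).
Proof.
move=> iJ; rewrite /neg_log_pl -sumrN; apply: eq_bigr => i _.
by rewrite ising_condE// lnV ?opprK// posrE expR_add1_gt0.
Qed.

Lemma lin_norm_le J M x i : infty_norm J <= M -> `|lin J x i| <= M.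
Proof.
move=> JM; apply: le_trans (infty_norm_row JM i).
apply: le_trans (ler_norm_sum _ _ _) _; apply: ler_sum => j _.
by rewrite normrM normr_spin mulr1.
Qed.

Lemma linB J K x i : lin (J - K) x i = lin J x i - lin K x i.
Proof.
by rewrite /lin -sumrB; apply: eq_bigr => j _; rewrite !mxE mulrBl.
Qed.

(** Strong convexity of each logistic loss, with the local field moving from
[lin K x i] to [lin J x i]. *)
Lemma neg_log_pl_gap (M : R) J K x : 0 < M ->
  interaction_matrix J -> interaction_matrix K ->
  infty_norm J <= M -> infty_norm K <= M ->
  neg_log_pl x K - neg_log_pl x J <= gain K (J - K) (expR (- (4 * M)) / 8) x.
Proof.
move=> M0 iJ iK JM KM; rewrite !neg_log_plE// -sumrB /gain /cross /sqlin mulr_sumr -sumrB.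
apply: ler_sum => i _.
set y := spin R x i * lin K x i; set d := spin R x i * lin (J - K) x i.
have -> : spin R x i * lin J x i = y + d.
  by rewrite /y /d linB; ring.
have yM : `|y| <= M by rewrite normrM normr_spin mul1r lin_norm_le.
have dM : `|d| <= 2 * M.
  rewrite normrM normr_spin mul1r linB; apply: le_trans (ler_normB _ _) _.
  by have := lin_norm_le x i JM; have := lin_norm_le x i KM; lra.
have := logistic_strongly_convex (ltW M0) yM dM.
have -> : d ^+ 2 = lin (J - K) x i ^+ 2 by rewrite exprMn sqr_spin mul1r.
have -> : d * (1 - th y) = lin (J - K) x i * res K x i.
  have -> : th y = spin R x i * th (lin K x i).
    by rewrite /y /spin; case: (x i); rewrite /= ?expr1 ?expr0 ?mulN1r ?mul1r ?thN.
  rewrite /d /res; have := spin2 R x i; set s := spin R x i => s2.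
  have -> : s * lin (J - K) x i * (1 - s * th (lin K x i)) =
    s * lin (J - K) x i - (s * s) * lin (J - K) x i * th (lin K x i) by ring.
  by rewrite s2; ring.
lra.
Qed.

(** The product of the tilt [ep^12 / (80^2 * 800)] and of the drift [ep^9 / 800],
where [ep = expR (- M)]. *)
Definition rate (M : R) : R := expR (- (21 * M)) / (80 * 800) ^+ 2.

(** The tilt is chosen so that [slack] equals [ep^10 / 80^2], the value for which
[drift_arithmetic] applies. *)
Lemma gain_tail (M : R) J K : 0 < M ->
  interaction_matrix J -> interaction_matrix K ->
  infty_norm J <= M -> infty_norm K <= M ->
  \sum_(x | 0 <= gain K (J - K) (expR (- (4 * M)) / 8) x) ising K x
    <= expR (- (rate M * sqfrob (J - K))).
Proof.
move=> M0 iJ iK JM KM; set c := expR _ / 8; set A := J - K.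
have [B BE] : {B | B = expR M} by exists (expR M).
have [ep epE] : {ep | ep = expR (- M)} by exists (expR (- M)).
have epB : ep * B = 1 by rewrite epE BE -expRD addNr expR0.
have MB : 1 + M <= B by rewrite BE; exact: expR_ge1Dx.
have B1 : 1 <= B by lra.
have Asym i j : A i j = A j i.
  by rewrite !mxE (interaction_sym iJ) (interaction_sym iK).
have A0 i : A i i = 0 by rewrite !mxE iJ.2 iK.2 subrr.
have KB i : \sum_j `|K i j| <= B.
  by apply: le_trans (infty_norm_row KM i) _; lra.
have AB i : \sum_j `|A i j| <= 2 * B.
  apply: (@le_trans _ _ (\sum_j (`|J i j| + `|K i j|))).
    by apply: ler_sum => j _; rewrite !mxE ler_normB.
  rewrite big_split/=.
  by have := infty_norm_row JM i; have := infty_norm_row KM i; lra.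
have powE k (y : R) : k%:R * M = y -> expR (- y) = ep ^+ k.
  by move=> <-; rewrite epE -expRM_natl mulrN.
have cE : c = ep ^+ 4 / 8 by rewrite /c (powE 4%N).
have ep0 : 0 < ep by rewrite epE; exact: expR_gt0.
have ep4 : ep ^+ 4 <= 1.
  by apply: exprn_ile1; [exact: ltW|rewrite epE expR_le1; lra].
have c0 : 0 <= c by rewrite cE divr_ge0// exprn_ge0// ltW.
have c1 : c <= 1 by rewrite cE; lra.
have [theta thetaE] : {t | t = ep ^+ 12 * (80 ^- 2 * 800^-1)} by eexists.
have theta0 : 0 < theta.
  by rewrite thetaE; apply: mulr_gt0; [exact: exprn_gt0|lra].
have slackE : slack B theta = ep ^+ 10 / 80 ^+ 2.
  rewrite /slack thetaE.
  have -> : 800 * B ^+ 2 * (ep ^+ 12 * (80 ^- 2 * 800^-1)) =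
      (ep * B) ^+ 2 * ep ^+ 10 / 80 ^+ 2 by field.
  by rewrite epB expr1n mul1r.
have Ksym := interaction_sym iK.
set H := tilted K A c theta.
have e0 h : (forall x, 0 <= h x) -> 0 <= gibbs_mean H h.
  by move=> h0; rewrite -(gibbs_mean_cst H 0); exact: le_gibbs_mean.
have u0 := e0 _ (sqlin_ge0 A); have v0 := e0 _ (sqres_ge0 K A).
have S0 := sqfrob_ge0 A.
have gapM x i : ep ^+ 2 <= 1 - `|th (lin K x i)|.
  by rewrite -(powE 2%N _ erefl) normr_th_gap// lin_norm_le.
(* With this weight the part of [sqres] bounded by [8 B S] costs a quarter of
   [ep^2 S]. *)
have eta0 : 0 < ep ^+ 3 / 16 by rewrite divr_gt0// exprn_gt0.
have hv := mean_sqres_le Ksym Asym iK.2 A0 B1 KB AB c0 c1 theta0.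
have hf := mean_cross_le Ksym Asym iK.2 A0 B1 KB AB c0 c1 theta0.
have hS := frob_le_mean Ksym Asym iK.2 A0 B1 KB AB c0 c1 theta0 gapM.
have hd := mean_dot_le K A c theta eta0.
rewrite slackE in hv hf hS.
have hS' := le_trans hS (lerD hd (lexx _)).
have drift := drift_arithmetic B1 epB u0 v0 S0 erefl hv hS' hf.
have tail : gibbs_mean H (gain K A c) <= - (ep ^+ 9 * sqfrob A / 800).
  apply: le_trans drift; rewrite -cE -mulNr -gibbs_meanZ -gibbs_meanD.
  by apply: le_gibbs_mean => x; rewrite /gain mulNr.
have := gibbs_chernoff (ltW theta0) tail.
rewrite /rate (powE 21%N _ erefl) => hc.
under eq_bigr => x _ do rewrite isingE.
rewrite -mulr_suml; apply: le_trans hc _.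
rewrite ler_expR lerN2 le_eqVlt; apply/orP; left; apply/eqP.
by rewrite thetaE; field.
Qed.

End PseudoLikelihood.

(** * Learning from a single sample *)

Section Learning.
Variables (R : realType) (n : nat).
Implicit Types (J K : 'M[R]_n) (Js : {fset 'M[R]_n}).

Lemma frobenius_sq J : frobenius_norm J ^+ 2 = sqfrob J.
Proof. by rewrite sqr_sqrtr// sqfrob_ge0. Qed.

(** Three is the least integer above [expR 1]. *)
Lemma lnln_ge0 : (3 <= n)%N -> 0 <= ln (ln n%:R) :> R.
Proof.
move=> n3; have n0 : 0 < n%:R :> R by rewrite ltr0n; lia.
apply: ln_ge0; rewrite -ler_expR lnK ?posrE//.
by apply: le_trans (expR1_le3 R) _; rewrite ler_nat.
Qed.

(** The inverse square root of [rate], up to the rounding of [21 / 2] to 11. *)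
Definition radius_factor (M : R) : R := 80 * 800 * expR (11 * M).

Lemma radius_factor_ge0 (M : R) : 0 <= radius_factor M.
Proof. by rewrite /radius_factor; have := expR_ge0 (11 * M); set e := expR _; lra. Qed.

Lemma rate_ge0 (M : R) : 0 <= rate M.
Proof. by apply: divr_ge0; [exact: expR_ge0|exact: sqr_ge0]. Qed.

Lemma rate_radius (M : R) : 0 < M -> 1 <= rate M * radius_factor M ^+ 2.
Proof.
move=> M0; rewrite /rate /radius_factor.
have [ep epE] : {ep | ep = expR (- M)} by exists (expR (- M)).
have [B BE] : {B | B = expR M} by exists (expR M).
have -> : expR (11 * M) = B ^+ 11 by rewrite BE -expRM_natl.
have -> : expR (- (21 * M)) = ep ^+ 21 by rewrite epE -expRM_natl mulrN.
have epB : ep * B = 1 by rewrite epE BE -expRD addNr expR0.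
have -> : ep ^+ 21 / (80 * 800) ^+ 2 * (80 * 800 * B ^+ 11) ^+ 2 = (ep * B) ^+ 21 * B by field.
by rewrite epB expr1n mul1r BE; have := expR_ge1Dx M; lra.
Qed.

(** If the minimiser is far from [K], then it is one of the far matrices of the
family and its gain over [K] is non-negative. Each far matrix does so with
probability at most [delta / N], by the choice of the radius. *)
Theorem pseudolikelihood_learning (M delta : R) Js K (Jhat : config n -> 'M[R]_n) :
  0 < M -> (3 <= n)%N -> 0 < delta < 1 ->
  (forall J, J \in Js -> interaction_matrix J /\ infty_norm J <= M) ->
  K \in Js -> (forall x, pl_minimizer Js x (Jhat x)) ->
  1 - delta <= ising_prob K [pred x : config n |
     frobenius_norm (Jhat x - K) <=
       radius_factor M * Num.sqrt (ln (#|` Js|)%:R + ln (1 / delta) + ln (ln n%:R))].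
Proof.
move=> M0 n3 /andP[d0 d1] hJs KJs hat.
set N : R := (#|` Js|)%:R; set L := _ + ln (ln _); 
have [rad radE] : {r | r = radius_factor M * Num.sqrt L} by eexists.
rewrite -radE.
have N1 : 1 <= N.
  rewrite ler1n cardfs_gt0; apply/fset0Pn; by exists K.
have L_ge : ln (N / delta) <= L.
  rewrite /L lnM ?posrE ?invr_gt0//; last lra.
  by rewrite div1r lerDl lnln_ge0.
have L0 : 0 <= L.
  by apply: le_trans L_ge; apply: ln_ge0; rewrite ler_pdivlMr//; lra.
have [iK KM] := hJs _ KJs.
pose bad J := rad < frobenius_norm (J - K).
pose wins J x := 0 <= gain K (J - K) (expR (- (4 * M)) / 8) x.
have tailJ J : J \in Js -> bad J -> \sum_(x | wins J x) ising K x <= delta / N.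
  move=> JJs badJ; have [iJ JM] := hJs _ JJs.
  apply: le_trans (gain_tail M0 iJ iK JM KM) _.
  rewrite /bad radE in badJ.
  have S_gt : radius_factor M ^+ 2 * L <= sqfrob (J - K).
    rewrite -frobenius_sq -{1}(sqr_sqrtr L0) -exprMn.
    rewrite ler_pXn2r ?nnegrE ?sqrtr_ge0 ?(ltW badJ)//.
    by apply: mulr_ge0; [exact: radius_factor_ge0|exact: sqrtr_ge0].
  apply: (@le_trans _ _ (expR (- ln (N / delta)))); last first.
    by rewrite -lnV ?posrE ?divr_gt0 ?lnK ?posrE ?invr_gt0 ?divr_gt0 ?invf_div//; lra.
  rewrite ler_expR lerN2; apply: le_trans L_ge _.
  apply: le_trans (ler_wpM2l (rate_ge0 M) S_gt); rewrite mulrA.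
  by apply: ler_peMl => //; exact: rate_radius.
set E := [pred x | _].
have -> : ising_prob K E = 1 - \sum_(x | ~~ E x) ising K x.
  by rewrite -(sum_ising K) (bigID E xpredT)/= addrK.
rewrite lerD2l lerN2.
apply: (@le_trans _ _ (\sum_(x | ~~ E x) \sum_(J <- Js | bad J) if wins J x then ising K x else 0)).
  apply: ler_sum => x; rewrite /E/= -ltNge => badx.
  have [hJ hmin] := hat x.
  have [iJ JM] := hJs _ hJ.
  rewrite (big_rem (Jhat x) hJ)/=.
  have -> : bad (Jhat x) by [].
  have -> : wins (Jhat x) x.
    apply: le_trans (neg_log_pl_gap x M0 iJ iK JM KM).
    by rewrite subr_ge0 hmin.
  rewrite lerDl; apply: sumr_ge0 => J _; case: ifP => // _; exact: ising_ge0.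
apply: (@le_trans _ _ (\sum_(J <- Js | bad J) \sum_(x | wins J x) ising K x)).
  rewrite exchange_big/=; apply: ler_sum => J _.
  rewrite [leRHS]big_mkcond/= [leRHS](bigID E)/= lerDr.
  by apply: sumr_ge0 => x _; case: ifP => // _; exact: ising_ge0.
apply: (@le_trans _ _ (\sum_(J <- Js | bad J) delta / N)).
  by rewrite big_seq_cond [leRHS]big_seq_cond; apply: ler_sum => J /andP[]; exact: tailJ.
apply: (@le_trans _ _ (\sum_(J <- Js) delta / N)).
  rewrite [leRHS](bigID bad)/= lerDl; apply: sumr_ge0 => J _.
  by apply: divr_ge0; [exact: ltW|lra].
rewrite big_const_seq count_predT iter_addr addr0.
rewrite -[leLHS]mulr_natr -/N divfK// gt_eqF//; lra.
Qed.

End Learning.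

(** * Programs with a time bound *)

Section Runs.
Variable R : realType.
Implicit Types (s : state R) (p q : prog) (Q I : state R -> Prop).

(** Total correctness with a time bound: [p] halts from [s] within [T] steps in a
state satisfying [Q]. *)
Definition runs p s (T : nat) Q : Prop :=
  exists t s', [/\ exec p s t s', (t <= T)%N & Q s'].

Lemma runs_instr c s T Q : (0 < T)%N -> Q (run_instr c s) -> runs (Instr c) s T Q.
Proof. by move=> T0 Qs; exists 1%N, (run_instr c s); split => //; exact: ExecInstr. Qed.

Lemma runs_step c p s T Q :
  runs p (run_instr c s) T Q -> runs (Seq (Instr c) p) s T.+1 Q.
Proof.
move=> [t [s' [e tT Qs]]]; exists (1 + t)%N, s'; split => //.
by apply: ExecSeq e; exact: ExecInstr.
Qed.

Lemma runs_seq p q s T U Q' Q :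
  runs p s T Q' -> (forall s', Q' s' -> runs q s' U Q) ->
  runs (Seq p q) s (T + U) Q.
Proof.
move=> [t [s1 [e1 tT Q1]]] /(_ _ Q1)[u [s2 [e2 uU Q2]]].
by exists (t + u)%N, s2; split; [exact: ExecSeq e1 e2|exact: leq_add|].
Qed.

Lemma runs_if c p q s T Q :
  (run_test c s -> runs p s T Q) -> (~~ run_test c s -> runs q s T Q) ->
  runs (If c p q) s T.+1 Q.
Proof.
move=> hp hq.
have [t [s' [e tT Qs]]] : runs (if run_test c s then p else q) s T Q.
  by case: ifPn.
by exists t.+1, s'; split => //; exact: ExecIf.
Qed.

Lemma runs_le p s T U Q : (T <= U)%N -> runs p s T Q -> runs p s U Q.
Proof. by move=> TU [t [s' [e tT Qs]]]; exists t, s'; split => //; exact: leq_trans TU. Qed.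

(** The invariant determines the counter, so the loop makes exactly [m] rounds; each
costs one more step than its body, for the test. *)
Lemma runs_for a b p (m T : nat) (I : nat -> state R -> Prop) s :
  (forall k s', I k s' -> nreg s' a = k /\ nreg s' b = m) ->
  (forall k s', (k < m)%N -> I k s' -> runs p s' T (I k.+1)) ->
  I 0%N s -> runs (While (NLt a b) p) s (m * T.+1 + 1) (I m).
Proof.
move=> regs body I0.
suff loop d : forall k s', (k + d = m)%N -> I k s' ->
    runs (While (NLt a b) p) s' (d * T.+1 + 1) (I m) by exact: loop (add0n m) I0.
elim: d => [|d IH] k s' kd Ik; have [ra rb] := regs _ _ Ik.
  exists 1%N, s'; rewrite addn0 in kd; split => //; last by rewrite -kd.
  by apply: ExecWhileF; rewrite /= ra rb -kd ltnn.
have km : (k < m)%N by lia.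
have [t [s1 [e1 tT I1]]] := body _ _ km Ik.
have [|u [s2 [e2 uU I2]]] := IH k.+1 s1 _ I1; first lia.
exists (t + u).+1, s2; split => //; last by lia.
by apply: ExecWhileT e1 e2; rewrite /= ra rb.
Qed.

End Runs.

(** * A program maximising the pseudo-likelihood *)

Section Program.

Fixpoint block (cs : seq instr) (p : prog) : prog :=
  if cs is c :: cs' then Seq (Instr c) (block cs' p) else p.

(** Natural-number registers: 0 dimension, 1 number of matrices, 2 the constant 1,
3 matrix index, 4 row, 5 column, 6 read head, 7 start of the current matrix,
8 start of the best matrix, 9 write head. Real registers: 0 pseudo-likelihood so
far, 1 best pseudo-likelihood, 2 current spin, 3 local field, 4 and 5 scratch,
6 the constant 1. *)
Definition field_body : prog :=
  block [:: RLoad 4 6; RLoad 5 5; RMul 4 4 5; RAdd 3 3 4; NAdd 6 6 2]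
    (Instr (NAdd 5 5 2)).

Definition row_body : prog :=
  block [:: RSet 3 0; NSet 5 0]
    (Seq (While (NLt 5 0) field_body)
      (block [:: RLoad 2 4; RMul 3 3 2; RSet 5 0; RSub 5 5 3; RSub 5 5 3;
                RExp 5 5; RAdd 5 5 6; RDiv 0 0 5] (Instr (NAdd 4 4 2)))).

Definition matrix_body : prog :=
  block [:: NMov 7 6; RSet 0 1; NSet 4 0]
    (Seq (While (NLt 4 0) row_body)
      (Seq (If (RLt 1 0) (block [:: RMov 1 0] (Instr (NMov 8 7))) Skip)
        (Instr (NAdd 3 3 2)))).

Definition copy_body : prog :=
  block [:: RLoad 4 8; RStore 9 4; NAdd 8 8 2; NAdd 9 9 2] (Instr (NAdd 5 5 2)).

Definition copy_row_body : prog :=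
  block [:: NSet 5 0] (Seq (While (NLt 5 0) copy_body) (Instr (NAdd 4 4 2))).

Definition pl_program : prog :=
  block [:: NSet 2 1; RSet 6 1; NMov 6 0; NMov 8 0; RSet 1 0; NSet 3 0]
    (Seq (While (NLt 3 1) matrix_body)
      (block [:: NSet 4 0; NSet 9 0] (While (NLt 4 0) copy_row_body))).

End Program.

(** * Correctness and running time of the program *)

Section Correctness.
Variables (R : realType) (n N : nat) (mem : nat -> R).
Implicit Types (st : state R).

(** Address arithmetic of the input: the entry [(i, j)] of the [k]-th matrix. *)
Definition cell k i j : R := mem (n + k * (n * n) + i * n + j)%N.

Definition field_upto k i m : R := \sum_(0 <= j < m) cell k i j * mem j.

(** The conditional probability of the [i]-th spin under the [k]-th matrix, written
exactly as the program computes it. *)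
Definition factor k i : R :=
  1 / (expR (0 - field_upto k i n * mem i - field_upto k i n * mem i) + 1).

Definition pl_upto k m : R := \prod_(0 <= i < m) factor k i.

Definition base st : Prop :=
  [/\ nreg st 0 = n, nreg st 1 = N, nreg st 2 = 1%N, rreg st 6 = 1 & rmem st = mem].

(** The record among the first [k] matrices. When [k = 0] there is none, but
register 8 already points to a valid matrix. *)
Definition best_upto k st : Prop :=
  exists b, [/\ (b < N)%N, nreg st 8 = (n + b * (n * n))%N &
    (0 < k)%N -> rreg st 1 = pl_upto b n /\
    forall l, (l < k)%N -> pl_upto l n <= pl_upto b n].

Lemma factor_gt0 k i : 0 < factor k i.
Proof. by rewrite divr_gt0// addr_gt0 ?expR_gt0. Qed.

Lemma pl_upto_gt0 k m : 0 < pl_upto k m.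
Proof. by apply: prodr_gt0 => i _; exact: factor_gt0. Qed.

Definition outer_inv k st : Prop :=
  [/\ base st, nreg st 3 = k, nreg st 6 = (n + k * (n * n))%N,
      k = 0%N -> rreg st 1 = 0 & best_upto k st].

Definition row_inv k (r1 : R) (n8 : nat) i st : Prop :=
  [/\ base st, [/\ nreg st 3 = k, nreg st 4 = i & nreg st 7 = (n + k * (n * n))%N],
      nreg st 6 = (n + k * (n * n) + i * n)%N,
      rreg st 0 = pl_upto k i & rreg st 1 = r1 /\ nreg st 8 = n8].

Definition field_inv k (r1 : R) (n8 : nat) i j st : Prop :=
  [/\ base st,
      [/\ nreg st 3 = k, nreg st 4 = i, nreg st 5 = j & nreg st 7 = (n + k * (n * n))%N],
      nreg st 6 = (n + k * (n * n) + i * n + j)%N,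
      rreg st 0 = pl_upto k i /\ rreg st 3 = field_upto k i j
    & rreg st 1 = r1 /\ nreg st 8 = n8].

Lemma field_body_runs k r1 n8 i j st : field_inv k r1 n8 i j st ->
  runs field_body st 6 (field_inv k r1 n8 i j.+1).
Proof.
move=> [[b0 b1 b2 b6 bm] [h3 h4 h5 h7] h6 [q0 q3] [q1 q8]].
do 5! apply: runs_step; apply: runs_instr => //.
split; rewrite /= /upd //=.
- by split; rewrite //= h5 b2 addn1.
- by rewrite h6 b2; lia.
- split=> //; rewrite q3 /field_upto big_nat_recr//= h6 h5 bm; congr (_ + _ * _).
Qed.

Lemma row_body_runs k r1 n8 i st : row_inv k r1 n8 i st ->
  runs row_body st (7 * n + 12) (row_inv k r1 n8 i.+1).
Proof.
move=> [[b0 b1 b2 b6 bm] [h3 h4 h7] h6 q0 [q1 q8]].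
apply: (@runs_le _ _ _ (n * 7 + 1 + 9).+2); first lia.
do 2! apply: runs_step.
apply: (@runs_seq _ _ _ _ _ _ (field_inv k r1 n8 i n)).
  apply: (@runs_for _ 5 0 _ n 6 (field_inv k r1 n8 i)).
  - by move=> j s' [[? _ _ _ _] [_ _ ? _] _ _ _].
  - by move=> j s' _; exact: field_body_runs.
  - split=> //=; rewrite /upd//=.
    + by rewrite addn0.
    + by split=> //; rewrite /field_upto big_geq.
move=> s' [[c0 c1 c2 c6 cm] [g3 g4 g5 g7] g6 [p0 p3] [p1 p8]].
do 8! apply: runs_step; apply: runs_instr => //.
split; rewrite /= /upd //=.
- by split; rewrite //= g4 c2 addn1.
- by rewrite g6; lia.
- rewrite p0 p3 g4 cm c6 /pl_upto big_nat_recr//= /factor; congr (_ * _).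
  by rewrite mul1r.
Qed.

(** Pseudo-likelihoods are positive, so the initial record 0 is beaten by the first
matrix and needs no special case in the program. *)
Lemma matrix_body_runs k st : (k < N)%N -> outer_inv k st ->
  runs matrix_body st (n * (7 * n + 13) + 10) (outer_inv k.+1).
Proof.
move=> kN [[b0 b1 b2 b6 bm] h3 h6 q0 [b [bN b8 hb]]].
set r1 := rreg st 1.
apply: (@runs_le _ _ _ (n * (7 * n + 12).+1 + 1 + (3 + 1)).+3); first lia.
do 3! apply: runs_step.
apply: (@runs_seq _ _ _ _ _ _ (row_inv k r1 (nreg st 8) n)).
  apply: (@runs_for _ 4 0 _ n (7 * n + 12) (row_inv k r1 (nreg st 8))).
  - by move=> j s' [[? _ _ _ _] [_ ? _] _ _ _].
  - by move=> j s' _; exact: row_body_runs.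
  - split=> //=; rewrite /upd//=.
    + by rewrite addn0.
    + by rewrite /pl_upto big_geq.
move=> s1 [[c0 c1 c2 c6 cm] [g3 g4 g7] g6 p0 [p1 p8]].
pose Q s2 := [/\ base s2, nreg s2 3 = k, nreg s2 6 = (n + k.+1 * (n * n))%N &
   best_upto k.+1 s2].
have g6' : nreg s1 6 = (n + k.+1 * (n * n))%N by rewrite g6 mulSn addnA addnAC.
apply: (@runs_seq _ _ _ _ _ _ Q).
  apply: runs_if => /= cmp.
    apply: runs_step; apply: runs_instr => //.
    split; rewrite /= /upd //=.
    exists k; split; rewrite //= p0; split => // l.
    rewrite ltnS leq_eqVlt => /orP[/eqP -> //|lk].
    have k0 : (0 < k)%N by lia.
    have [r1E best] := hb k0.
    apply: le_trans (best _ lk) _.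
    by rewrite -r1E -/r1 -p1 -p0 ltW.
  exists 1%N, s1; split=> //; first exact: ExecSkip.
  split=> //.
  exists b; split=> // [|_]; first by rewrite p8.
  (* A failed comparison excludes the first round, where the record is 0. *)
  have k0 : (0 < k)%N.
    rewrite lt0n; apply/eqP => k0; move: cmp.
    by rewrite p0 p1 /r1 q0// pl_upto_gt0.
  have [r1E best] := hb k0.
  split; first by rewrite p1.
  move=> l; rewrite ltnS leq_eqVlt => /orP[/eqP ->|/best//].
  by rewrite -r1E -/r1 -p1 -p0 leNgt.
move=> s2 [[d0 d1 d2 d6 dm] e3 e6 [b' [bN' b8' hb']]].
apply: runs_instr => //; split; rewrite /= /upd//=.
- by rewrite e3 d2 addn1.
- by exists b'.
Qed.

(** Copying runs forwards and the source lies at least [n] cells ahead of the target,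
so no cell is overwritten before it has been read. *)
Definition copied b m st : Prop :=
  [/\ nreg st 2 = 1%N, nreg st 8 = (n + b * (n * n) + m)%N, nreg st 9 = m &
      forall l, rmem st l = if (l < m)%N then mem (n + b * (n * n) + l)%N else mem l].

Lemma copy_body_runs b i j st : (0 < n)%N ->
  [/\ nreg st 0 = n, nreg st 4 = i, nreg st 5 = j & copied b (i * n + j) st] ->
  runs copy_body st 5 (fun st' => [/\ nreg st' 0 = n, nreg st' 4 = i,
     nreg st' 5 = j.+1 & copied b (i * n + j.+1) st']).
Proof.
move=> n0 [r0 r4 r5 [r2 r8 r9 hm]].
do 4! apply: runs_step; apply: runs_instr => //.
split; rewrite /= /upd //=; first by rewrite r5 r2 addn1.
split; rewrite /= /upd/= ?r8 ?r9 ?r2//; try lia.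
move=> l; case: eqP => [->|/eqP lm].
  rewrite hm; case: ltnP => [|_]; first by lia.
  by case: ltnP => //; lia.
rewrite hm; have -> // : (l < i * n + j.+1)%N = (l < i * n + j)%N.
by apply/idP/idP; lia.
Qed.

Lemma copy_runs b st : (0 < n)%N ->
  [/\ nreg st 0 = n, nreg st 4 = 0%N & copied b 0 st] ->
  runs (While (NLt 4 0) copy_row_body) st (n * (6 * n + 4) + 1)
    (fun st' => copied b (n * n) st').
Proof.
move=> n0 [r0 r4 cp].
pose I i st := [/\ nreg st 0 = n, nreg st 4 = i & copied b (i * n) st].
have : runs (While (NLt 4 0) copy_row_body) st (n * (6 * n + 3).+1 + 1) (I n).
  apply: runs_for => //.
  - by move=> k s' [].
  - move=> i s' _ [a0 a4 cp'].
    apply: (@runs_le _ _ _ (n * 6 + 1 + 1).+1); first lia.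
    apply: runs_step.
    pose I' j st := [/\ nreg st 0 = n, nreg st 4 = i, nreg st 5 = j
      & copied b (i * n + j) st].
    apply: (@runs_seq _ _ _ _ _ _ (I' n)).
      apply: (@runs_for _ 5 0 _ n 5 I').
      + by move=> k s1 [].
      + by move=> j s1 _; exact: copy_body_runs.
      + split; rewrite //= addn0.
        by case: cp' => c2 c8 c9 cm; split.
    move=> s1 [d0 d4 d5 [c2 c8 c9 cm]].
    apply: runs_instr => //; split; rewrite /= /upd//= ?d4 ?c2 ?addn1//.
    by rewrite mulSn addnC; split.
move=> [t [s' [e tT [_ _ cp']]]].
by exists t, s'; split => //; lia.
Qed.

Theorem pl_program_runs st : (0 < n)%N -> (0 < N)%N ->
  nreg st 0 = n -> nreg st 1 = N -> rmem st = mem ->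
  runs pl_program st (N * (n * (7 * n + 13) + 11) + n * (6 * n + 4) + 10)
    (fun st' => exists b, [/\ (b < N)%N,
       forall l, (l < N)%N -> pl_upto l n <= pl_upto b n &
       forall l, (l < n * n)%N -> rmem st' l = mem (n + b * (n * n) + l)%N]).
Proof.
move=> n0 N0 r0 r1 hm.
apply: (@runs_le _ _ _
  (N * (n * (7 * n + 13) + 10).+1 + 1 + (n * (6 * n + 4) + 1).+2).+4.+2); first lia.
do 6! apply: runs_step.
apply: (@runs_seq _ _ _ _ _ _ (outer_inv N)).
  apply: runs_for.
  - by move=> k s' [[]].
  - by move=> k s' kN; exact: matrix_body_runs.
  - split; rewrite /= /upd//= ?r0 ?addn0//.
    by exists 0%N; split; rewrite //= ?r0 ?addn0.
move=> s1 [[c0 c1 c2 c6 cm] g3 g6 _ [b [bN b8 /(_ N0)[_ best]]]].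
do 2! apply: runs_step.
have [|t [s2 [e tT [d2 d8 d9 dm]]]] := @copy_runs b
  (run_instr (NSet 9 0) (run_instr (NSet 4 0) s1)) n0.
  split; rewrite //=; split; rewrite //= /upd/= ?b8 ?addn0//.
  by move=> l; rewrite cm.
exists t, s2; split=> //; exists b; split=> // l ln.
by rewrite dm ln.
Qed.

End Correctness.

(** * Memory layout *)

Lemma nth_flatten_block (T : Type) (x0 : T) (ss : seq (seq T)) m k l :
  all (fun s => size s == m) ss -> (k < size ss)%N -> (l < m)%N ->
  nth x0 (flatten ss) (k * m + l) = nth x0 (nth [::] ss k) l.
Proof.
elim: ss k => // s ss IH [|k] /= /andP[/eqP sm ssm] kss lm.
  by rewrite mul0n add0n nth_cat sm lm.
rewrite nth_cat sm mulSn -addnA ltnNge leq_addr/= addKn; exact: IH.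
Qed.

Section Layout.
Variables (R : realType) (n : nat) (x : config n) (s : seq 'M[R]_n).
Implicit Types (J : 'M[R]_n) (i j : 'I_n).

Lemma size_mx_entries J : size (mx_entries J) = (n * n)%N.
Proof. by rewrite size_allpairs size_enum_ord. Qed.

Lemma nth_mx_entries J i j : nth 0 (mx_entries J) (i * n + j) = J i j.
Proof.
rewrite -[mx_entries J]/(flatten [seq [seq J i j | j <- enum 'I_n] | i <- enum 'I_n]).
rewrite (@nth_flatten_block _ _ _ n) ?size_map ?size_enum_ord ?ltn_ord//.
  by rewrite (nth_map i) ?size_enum_ord// (nth_map j) ?size_enum_ord// !nth_ord_enum.
  by apply/allP => r /mapP[k _ ->]; rewrite size_map size_enum_ord.
by rewrite -enumT size_enum_ord.
Qed.

Let mem : nat -> R := rmem (input_state x s).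

Lemma input_spin i : mem i = spin R x i.
Proof.
rewrite /mem /= nth_cat size_map size_enum_ord ltn_ord.
by rewrite (nth_map i) ?size_enum_ord// nth_ord_enum mxE.
Qed.

Lemma input_block k l : (k < size s)%N -> (l < n * n)%N ->
  mem (n + k * (n * n) + l)%N = nth 0 (mx_entries (nth 0 s k)) l.
Proof.
move=> ks ln; rewrite /mem /= nth_cat size_map size_enum_ord -addnA.
rewrite ltnNge leq_addr/= addKn (@nth_flatten_block _ _ _ (n * n)%N) ?size_map//.
  by rewrite (nth_map 0).
by apply/allP => r /mapP[J _ ->]; rewrite size_mx_entries.
Qed.

Lemma ord_pair_lt i j : (i * n + j < n * n)%N.
Proof. by have := ltn_ord i; have := ltn_ord j; nia. Qed.

Lemma input_cell k i j : (k < size s)%N -> cell n mem k i j = nth 0 s k i j.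
Proof.
by move=> ks; rewrite /cell -addnA input_block ?ord_pair_lt// nth_mx_entries.
Qed.

Lemma input_field k i : (k < size s)%N ->
  field_upto n mem k i n = lin (nth 0 s k) x i.
Proof.
move=> ks; rewrite /field_upto big_mkord; apply: eq_bigr => j _.
by rewrite input_cell// input_spin.
Qed.

Lemma input_pl k : (k < size s)%N -> interaction_matrix (nth 0 s k) ->
  pl_upto n mem k n = expR (- neg_log_pl x (nth 0 s k)).
Proof.
move=> ks iJ; rewrite neg_log_plE// -sumrN expR_sum /pl_upto big_mkord.
apply: eq_bigr => i _; rewrite [RHS]expRN lnK ?posrE ?expR_add1_gt0//.
rewrite /factor input_field// input_spin.
rewrite mul1r addrC; congr ((_ + expR _)^-1); ring.
Qed.

End Layout.

Theorem pl_program_minimizes (R : realType) (n : nat) (s : seq 'M[R]_n) (x : config n) :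
  (0 < n)%N -> (0 < size s)%N -> (forall J, J \in s -> interaction_matrix J) ->
  exists t st J, [/\ exec pl_program (input_state x s) t st,
    (t <= 51 * (size s + n) ^ 3)%N, outputs_mx st J, J \in s &
    forall K, K \in s -> neg_log_pl x J <= neg_log_pl x K].
Proof.
move=> n0 s0 iJ.
have [t [st [e tT [b [bs best out]]]]] :=
  pl_program_runs n0 s0 (erefl : nreg (input_state x s) 0 = n)
     (erefl : nreg (input_state x s) 1 = size s) erefl.
exists t, st, (nth 0 s b); split; [exact: e| | |exact: mem_nth|].
- apply: leq_trans tT _; move: (size s) s0 => N s0; rewrite !expnS expn0 muln1.
  have : (n <= N + n)%N by lia.
  have : (N <= N + n)%N by lia.
  have : (0 < N + n)%N by lia.
  move: (N + n)%N => m m0 Nm nm.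
  have h2 : (n * n <= m * m)%N by exact: leq_mul.
  have h3 : (N * (n * n) <= m * (m * m))%N by exact: leq_mul.
  have h4 : (N * n <= m * m)%N by exact: leq_mul.
  have h5 : (m * m <= m * (m * m))%N by rewrite leq_pmull.
  have h6 : (m <= m * m)%N by rewrite leq_pmull.
  lia.
- apply: (@eq_from_nth _ 0) => [|l]; rewrite size_mkseq ?size_mx_entries// => ln.
  by rewrite nth_mkseq// out// input_block.
- move=> K Ks; have ks : (index K s < size s)%N by rewrite index_mem.
  have plb := input_pl x bs (iJ _ (mem_nth 0 bs)).
  have plK := input_pl x ks (iJ _ (mem_nth 0 ks)).
  rewrite nth_index// in plK.
  by have := best _ ks; rewrite plb plK ler_expR lerN2.
Qed.

Theorem corollary1 (R : realType) :
  exists (C : R -> R) (p : prog) (c d : nat),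
    singly_exponential C /\
    forall (M : R) (n : nat) (delta : R) (Js : {fset 'M[R]_n}) (Jstar : 'M[R]_n),
      0 < M -> (3 <= n)%N -> 0 < delta < 1 ->
      (forall J, J \in Js -> interaction_matrix J /\ infty_norm J <= M) ->
      Jstar \in Js ->
      (forall Jhat : config n -> 'M[R]_n,
          (forall x, pl_minimizer Js x (Jhat x)) ->
          1 - delta <=
          ising_prob Jstar
            [pred x : config n |
               frobenius_norm (Jhat x - Jstar) <=
               C M * Num.sqrt (ln (#|` Js|)%:R + ln (1 / delta)
                               + ln (ln n%:R))])
      /\
      (forall (s : seq 'M[R]_n) (x : config n),
          uniq s -> s =i Js ->
          exists (t : nat) (st : state R) (J : 'M[R]_n),
            [/\ exec p (input_state x s) t st,
                (t <= c * (#|` Js| + n) ^ d)%N,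
                outputs_mx st J
              & pl_minimizer Js x J]).
Proof.
exists (@radius_factor R), pl_program, 51%N, 3%N; split.
  exists (80 * 800), 11; split=> [||M _]; [lra|lra|exact: lexx].
move=> M n delta Js Jstar M0 n3 delta01 hJs JJs; split=> [Jhat hat|s x us sJ].
  exact: (pseudolikelihood_learning M0 n3 delta01 hJs JJs hat).
have sizeE : size s = #|` Js|.
  by apply: perm_size; apply: uniq_perm => //; exact: fset_uniq.
have s0 : (0 < size s)%N by rewrite sizeE cardfs_gt0; apply/fset0Pn; exists Jstar.
have n0 : (0 < n)%N by lia.
have iJ J : J \in s -> interaction_matrix J by rewrite sJ => /hJs[].
have [t [st [J [e tT out Js_ Jmin]]]] := pl_program_minimizes x n0 s0 iJ.
exists t, st, J; split=> //; first by rewrite -sizeE.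
by split=> [|K KJs]; [rewrite -sJ|apply: Jmin; rewrite sJ].
Qed.
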